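(* Let $n\ge1$ and $Q=n+2\ge3$. Let $k\ge1$ be an integer less than $Q$, and let $1<p<\frac{Q}{k}$ and $\beta\in\mathbb{R}$. Then for every $u\in C_0^\infty(\mathbb{R}^{n+1})$: (i) If $k=2l$ with $l\ge1$ and $-(2l-2)p-Q(p-1)<\beta<Q-2lp$, then $$\int_{\mathbb{R}^{n+1}}\frac{|\mathcal{L}_{\varrho,G}^{\,l}u(x,t)|^p}{|\nabla_G\varrho(x,t)|^{(2l-1)p}\varrho^\beta(x,t)}\,dx\,dt\ \ge\ C_{k,p,\beta}\int_{\mathbb{R}^{n+1}}\frac{|u(x,t)|^p|\nabla_G\varrho(x,t)|^p}{\varrho^{2lp+\beta}(x,t)}\,dx\,dt.$$ (ii) If $k=2l+1$ with $l\ge0$ and $-(2l-1)p-Q(p-1)<\beta<Q-(2l+1)p$, then $$\int_{\mathbb{R}^{n+1}}\frac{|\nabla_{\varrho,G}\mathcal{L}_{\varrho,G}^{\,l}u(x,t)|^p}{|\nabla_G\varrho(x,t)|^{2lp}\varrho^\beta(x,t)}\,dx\,dt\ \ge\ C_{k,p,\beta}\int_{\mathbb{R}^{n+1}}\frac{|u(x,t)|^p|\nabla_G\varrho(x,t)|^p}{\varrho^{(2l+1)p+\beta}(x,t)}\,dx\,dt.$$ Moreover, all the constants $C_{k,p,\beta}$ are sharp.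
   Context: Grushin space $G=\mathbb{R}^{n+1}$: points $(x,t)$ with $x\in\mathbb{R}^n$, $t\in\mathbb{R}$; origin $o=(\vec 0,0)$; homogeneous dimension $Q=n+2$; homogeneous norm $\varrho(x,t)=(|x|^4+4t^2)^{1/4}$; Grushin gradient $\nabla_G=(\nabla_x,|x|\partial_t)$, so that $|\nabla_G\varrho|^2=|x|^2/\varrho^2=:\psi$ away from $o$. Polar coordinates $(\varrho,\phi,w)$: $x=\varrho\sin^{1/2}\!\phi\;w$, $w\in\mathbb{S}^{n-1}$, $t=\frac{\varrho^2}{2}\cos\phi$, $0<\phi<\pi$. $\partial_\varrho$ is the partial derivative in $\varrho$ in these coordinates, i.e. $\partial_\varrho u=\frac1\varrho(x\cdot\nabla_xu+2t\,\partial_tu)$. Radial operators: $\nabla_{\varrho,G}u=\psi^{1/2}(\partial_\varrho u,0,0)$, so $|\nabla_{\varrho,G}u|=\psi^{1/2}|\partial_\varrho u|$, and $\mathcal{L}_{\varrho,G}u=\psi\big(\partial_\varrho^2u+\frac{Q-1}{\varrho}\partial_\varrho u\big)$; $\mathcal{L}_{\varrho,G}^{\,l}$ is the $l$-fold iterate ($\mathcal{L}^{\,0}_{\varrho,G}u=u$). $C_0^\infty$ denotes smooth compactly supported real-valued functions. Constants: $\Lambda_1(Q,p,\beta)=\big(\frac{Q-p-\beta}{p}\big)^p$; for integers $k\ge2$, $\Lambda_k(Q,p,\beta)=\Big(\frac{(Q(p-1)+\beta+(k-2)p)(Q-\beta-kp)}{p^2}\Big)^p$; $C_{2l,p,\beta}=\prod_{i=1}^{l}\Lambda_{2i}(Q,p,\beta)$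 and $C_{2l+1,p,\beta}=\prod_{i=0}^{l}\Lambda_{2i+1}(Q,p,\beta)$. ''Sharp'' means the constant cannot be replaced by a larger one.
   Formalization: For k≥2 the base of the p-th power in Λ_k(Q,p,β) is taken in absolute value, since in the stated range of β the factors Λ_{k'} of C_{k,p,β} with smaller index k' can have a negative base, where the real power is undefined or the resulting constant is not sharp. *)

(* Defs.v *)
From HB Require Import structures.
From mathcomp Require Import all_boot all_order all_algebra.
From mathcomp Require Import all_classical all_reals all_analysis.

Set Implicit Arguments.
Unset Strict Implicit.
Unset Printing Implicit Defensive.

Import Order.TTheory GRing.Theory Num.Theory.
Import numFieldNormedType.Exports.

Local Open Scope classical_set_scope.
Local Open Scope ring_scope.

Section measurable_rV.
Context {R : realType} (n : nat).

Let coors : 'I_n -> 'rV[R]_n -> measurableTypeR R := fun i x => x ord0 i.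

Let rV_set0 : g_sigma_preimage coors set0.
Proof. exact: sigma_algebra0. Qed.

Let rV_setC A : g_sigma_preimage coors A -> g_sigma_preimage coors (~` A).
Proof. exact: sigma_algebraC. Qed.

Let rV_bigcup (F : _^nat) : (forall i, g_sigma_preimage coors (F i)) ->
  g_sigma_preimage coors (\bigcup_i (F i)).
Proof. exact: sigma_algebra_bigcup. Qed.

HB.instance Definition _ := @isMeasurable.Build default_measure_display
  'rV[R]_n (g_sigma_preimage coors) rV_set0 rV_setC rV_bigcup.

Lemma measurable_coord_rV (i : 'I_n) :
  measurable_fun [set: 'rV[R]_n] (fun v => v ord0 i : measurableTypeR R).
Proof.
move=> _ Y mY; rewrite setTI; apply: sub_sigma_algebra => /=.
rewrite -bigcup_seq/=; exists i => /=; first by rewrite mem_index_enum.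
by exists Y => //; rewrite setTI.
Qed.

Lemma measurable_fun_rV d (T : measurableType d) (f : T -> 'rV[R]_n) :
  (forall i, measurable_fun [set: T] (fun x => f x ord0 i : measurableTypeR R)) ->
  measurable_fun [set: T] f.
Proof.
move=> mf.
suff prefS : g_sigma_preimage (fun i => coors i \o f) `<=` measurable.
  rewrite g_sigma_preimage_comp in prefS.
  by move=> _ A mA; apply: prefS; exists A.
apply: smallest_sub; first exact: sigma_algebra_measurable.
move=> A; rewrite -bigcup_seq => -[i _ [B mB <-]].
exact: (mf i).
Qed.

End measurable_rV.

Section lebesgue_rV.
Context {R : realType}.

Definition cons_rV n (p : measurableTypeR R * 'rV[R]_n) : 'rV[R]_n.+1 :=
  row_mx (p.1)%:M p.2.

Definition uncons_rV n (v : 'rV[R]_n.+1) : measurableTypeR R * 'rV[R]_n :=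
  (v ord0 ord0, rsubmx (v : 'rV_(1 + n))).

Lemma cons_rVK n : cancel (@cons_rV n) (@uncons_rV n).
Proof.
move=> [x v]; rewrite /uncons_rV /cons_rV row_mxKr/=; congr pair.
rewrite (_ : ord0 = lshift n (ord0 : 'I_1)); last exact/val_inj.
by rewrite (@row_mxEl _ 1 1 n) mxE eqxx mulr1n.
Qed.

Lemma uncons_rVK n : cancel (@uncons_rV n) (@cons_rV n).
Proof.
move=> v; rewrite /uncons_rV /cons_rV /=; apply/rowP => i.
case: (@split_ordP 1 n i) => j ->.
- rewrite (@row_mxEl _ 1 1 n) mxE !ord1 mulr1n.
  by congr (v _ _); exact/val_inj.
- by rewrite (@row_mxEr _ 1 1 n) mxE.
Qed.

Lemma measurable_cons_rV n : measurable_fun setT (@cons_rV n).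
Proof.
apply: measurable_fun_rV => i.
case: (@split_ordP 1 n i) => j ->.
- rewrite [X in measurable_fun _ X](_ : _ = fst) //.
  by apply/funext => -[x v]; rewrite /cons_rV (@row_mxEl _ 1 1 n) mxE !ord1 mulr1n.
- rewrite [X in measurable_fun _ X](_ : _ =
    (fun v : 'rV[R]_n => v ord0 j : measurableTypeR R) \o snd).
    by apply: measurableT_comp => //; exact: measurable_coord_rV.
  by apply/funext => -[x v]; rewrite /cons_rV (@row_mxEr _ 1 1 n).
Qed.

Lemma measurable_uncons_rV n : measurable_fun setT (@uncons_rV n).
Proof.
apply: measurable_fun_pair; first exact: measurable_coord_rV.
apply: measurable_fun_rV => i.
rewrite [X in measurable_fun _ X](_ : _ =
  (fun v : 'rV[R]_n.+1 => v ord0 (rshift 1 i) : measurableTypeR R)).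
  exact: measurable_coord_rV.
by apply/funext => v; rewrite mxE.
Qed.

Section step.
Context (n : nat) (mu : {sigma_finite_measure set 'rV[R]_n -> \bar R}).

Definition lebesgue_rV_step :=
  pushforward (@lebesgue_measure R \x mu)%E (@cons_rV n).

Let step_measure : {measure set 'rV[R]_n.+1 -> \bar R} :=
  measure_function_pushforward__canonical__measure_function_Measure
    (lebesgue_measure \x mu)%E (@measurable_cons_rV n).

HB.instance Definition _ := isMeasure.Build _ _ _ lebesgue_rV_step
  (measure0 step_measure) (measure_ge0 step_measure)
  (@measure_semi_sigma_additive _ _ _ step_measure).

Let lebesgue_rV_step_sigma_finite : sigma_finite setT lebesgue_rV_step.
Proof.
have /sigma_finiteP[F [UF ndF mF]] := sigma_finiteT (@lebesgue_measure R).
have /sigma_finiteP[G [UG ndG mG]] := sigma_finiteT mu.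
exists (fun k => @uncons_rV n @^-1` (F k `*` G k)).
  rewrite -preimage_bigcup (_ : \bigcup_k _ = setT) ?preimage_setT//.
  apply/seteqP; split=> // -[x v] _.
  have [i _ Fx] : (\bigcup_k F k) x by rewrite -UF.
  have [j _ Gv] : (\bigcup_k G k) v by rewrite -UG.
  exists (maxn i j) => //; split=> /=.
  - by move: x Fx; exact/subsetPset/ndF/leq_maxl.
  - by move: v Gv; exact/subsetPset/ndG/leq_maxr.
move=> k; have [mFk Fk_oo] := mF k; have [mGk Gk_oo] := mG k; split.
  rewrite -[X in measurable X]setTI; apply: measurable_uncons_rV => //.
  exact: measurableX.
rewrite /lebesgue_rV_step /pushforward -comp_preimage.
rewrite (_ : _ \o _ = id); last by apply/funext => p /=; rewrite cons_rVK.
by rewrite preimage_id product_measure1E// lte_mul_pinfty// ge0_fin_numE.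
Qed.

HB.instance Definition _ := Measure_isSigmaFinite.Build _ _ _
  lebesgue_rV_step lebesgue_rV_step_sigma_finite.

End step.

Fixpoint lebesgue_rV (n : nat) : {sigma_finite_measure set 'rV[R]_n -> \bar R} :=
  match n with
  | 0 => dirac (0 : 'rV[R]_0)
  | m.+1 => lebesgue_rV_step (lebesgue_rV m)
  end.

Lemma lebesgue_rVS n (A : set (measurableTypeR R)) (B : set 'rV[R]_n) :
  measurable A -> measurable B ->
  lebesgue_rV n.+1 (@uncons_rV n @^-1` (A `*` B)) =
    (lebesgue_measure A * lebesgue_rV n B)%E.
Proof.
move=> mA mB; rewrite /= /lebesgue_rV_step /pushforward -comp_preimage.
rewrite (_ : _ \o _ = id); last by apply/funext => p /=; rewrite cons_rVK.
by rewrite preimage_id product_measure1E.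
Qed.

End lebesgue_rV.

Section test_functions.
Context {R : realType} {V : normedModType R}.
Implicit Types f : V -> R.

Definition iter_derive (s : seq V) f : V -> R :=
  foldr (fun v g => 'D_v g) f s.

Definition smooth f := forall s : seq V,
  continuous (iter_derive s f) /\
  (forall z v, derivable (iter_derive s f) z v).

Definition compactly_supported f := compact (closure [set z | f z != 0]).

Definition test_function f := smooth f /\ compactly_supported f.

End test_functions.

Section grushin.
Context {R : realType} {n : nat}.

Definition grushin : normedModType R := ('rV[R]_n * R^o)%type.

Implicit Types (u : grushin -> R) (z : grushin).

Definition grushin_measure : set ('rV[R]_n * measurableTypeR R) -> \bar R :=
  (lebesgue_rV n \x lebesgue_measure)%E.

HB.instance Definition _ := Measure.on grushin_measure.

Definition hdim : R := n%:R + 2.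

Definition enorm m (v : 'rV[R]_m) : R := Num.sqrt (\sum_(i < m) v ord0 i ^+ 2).

Definition rho z : R := (enorm z.1 ^+ 4 + 4 * z.2 ^+ 2) `^ (4^-1).

Definition partial_x (i : 'I_n) u : grushin -> R :=
  'D_((delta_mx ord0 i, 0) : grushin) u.

Definition partial_t u : grushin -> R := 'D_((0, 1) : grushin) u.

Definition grushin_grad u z : 'rV[R]_(n + 1) :=
  row_mx (\row_i partial_x i u z) (enorm z.1 * partial_t u z)%:M.

(* At the origin, a null set, rho vanishes and the value is irrelevant; the same
   holds for the operators below. *)
Definition psi z : R := enorm z.1 ^+ 2 / rho z ^+ 2.

Definition partial_rho u z : R :=
  (rho z)^-1 *
    (\sum_(i < n) z.1 ord0 i * partial_x i u z + 2 * z.2 * partial_t u z).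

(* Components in the orthonormal polar frame; only the first one, along rho,
   is nonzero. *)
Definition radial_grad u z : 'rV[R]_n.+1 :=
  \row_(i < n.+1) if i == ord0 then Num.sqrt (psi z) * partial_rho u z else 0.

Definition radial_lap u z : R :=
  psi z * (partial_rho (partial_rho u) z +
           (hdim - 1) / rho z * partial_rho u z).

End grushin.

Section constants.
Context {R : realType}.

(* For k = 1 the base of the power is positive whenever beta < Q - p.  For
   k >= 2 it may be negative, e.g. Lambda Q p beta 2, a factor of
   rellich_constant Q p beta 4, when -2p - Q(p-1) < beta < -Q(p-1).  A real power
   of a negative number is undefined (and powR returns 1 there), hence the
   absolute value; it is the identity where the base is nonnegative. *)
Definition Lambda (Q p beta : R) (k : nat) : R :=
  if k == 1%N then ((Q - p - beta) / p) `^ p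
  else `|(Q * (p - 1) + beta + (k%:R - 2) * p) * (Q - beta - k%:R * p) / p ^+ 2|
         `^ p.

Definition rellich_constant (Q p beta : R) (k : nat) : R :=
  if odd k then \prod_(0 <= i < k./2.+1) Lambda Q p beta i.*2.+1
  else \prod_(1 <= i < k./2.+1) Lambda Q p beta i.*2.

End constants.

(* C is the largest c such that c * rhs u <= lhs u for all test functions. *)
Definition sharp_inequality (R : realType) (V : normedModType R)
    (lhs rhs : (V -> R) -> \bar R) (C : R) :=
  (forall u, test_function u -> C%:E * rhs u <= lhs u)%E /\
  (forall C', (forall u, test_function u -> C'%:E * rhs u <= lhs u)%E -> C' <= C).

(* Main.v *)
Require Import Defs.
From HB Require Import structures.
From mathcomp Require Import all_boot all_order all_algebra.
From mathcomp Require Import all_classical all_reals all_analysis.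
From mathcomp Require Import measurable_realfun.
From mathcomp Require Import ring lra.

Set Implicit Arguments.
Unset Strict Implicit.
Unset Printing Implicit Defensive.

Import Order.TTheory GRing.Theory Num.Theory.
Import numFieldNormedType.Exports.

Local Open Scope classical_set_scope.
Local Open Scope ring_scope.


(** Write [Z = x . grad_x + 2 t d_t], the generator of the dilations
    [(x, t) |-> (e^s x, e^(2s) t)], and [psi = |x|^2 / rho^2].  Then
    [d_rho = rho^-1 Z], and since [psi] and [rho] are homogeneous,
    [L^l u = psi^l rho^(-2l) prod_(j < l) (Z - 2j) (Z - 2j + Q - 2) u].
    Hence both sides of the inequality are of the form
    [I(v) = \int psi^(p/2) rho^(-kp-beta) |v|^p]: the right one is [I(u)], the left one
    is [I(prod (Z + c_i) u)] with [k] factors.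

    Along a dilation orbit, with [s0 = (kp + beta - Q) / p < 0], put
    [g s = e^(-s0 s) v(e^s x, e^(2s) t)]; then [(Z + c) v] becomes [g' + (s0 + c) g].
    Convexity of [|.|^p] gives
    [|g' + a g|^p >= |a g|^p + (sg(a) |a|^(p-1) |g|^p)'], and integrating over the orbits
    yields [I((Z + c) v) >= |s0 + c|^p I(v)].  The product of these constants is the
    Rellich constant.

    For sharpness, test with [u = rho^s0 B(e ln rho)], [B] a bump function: [Z + c] then
    acts on [B] as [(s0 + c) + e d/dx], and [e -> 0]. *)

(** * Smooth functions *)

(** The product of the one-step constants stays sharp because the steps share their extremals. [psi]
    and the angular variables are constant along dilations and enter only as a weight on the set of
    orbits, while [Z + c] acts on every orbit as the same operator with constant coefficients. One
    near-eigenfunction, a truncated [rho^s0], is almost extremal for all these operators at once.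
    The exponent [s0] is the one that makes the weighted integrand homogeneous of degree [-Q], hence
    dilation invariant. As [s0 < 0], [g] decays for [s -> -oo] even when [v] does not vanish at the
    origin, so no boundary term survives.

    Integrals take values in [[0, +oo]], so no integrability of intermediate functions has to be
    tracked. Orbits are not parametrised by a sphere: a shell that each orbit crosses in unit time
    takes its place, and only the scaling law of the measure is used. Since [rho] and [psi] are
    singular at the origin, computations go through the polynomials [sqn = |x|^2] and
    [gauge = rho^4]. *)

Section smooth_algebra.
Context {R : realType}.

Definition smooth1 (h : R -> R) := forall m x, derivable (derive1n m h) x 1.

Lemma smooth1_derive1 h : smooth1 h -> smooth1 (derive1 h).
Proof. by move=> sh m x; rewrite -derive1Sn; exact: sh. Qed.

Lemma smooth1_continuous h : smooth1 h -> continuous h.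
Proof.
move=> sh x; apply/differentiable_continuous/derivable1_diffP.
exact: (sh 0%N).
Qed.

Lemma smooth1_is_derive h (x : R) : smooth1 h -> is_derive x (1 : R) h (derive1 h x).
Proof. by move=> sh; rewrite derive1E; apply/derivableP/(sh 0%N). Qed.

Context {V : normedModType R}.
Implicit Types (f g : V -> R) (h : R -> R).

(** Brings directional derivatives within reach of one-variable calculus. *)
Lemma is_derive_line f z v df :
  is_derive z v f df <-> is_derive (0 : R) 1 (fun t : R => f (t *: v + z)) df.
Proof.
have E : 'D_v f z = 'D_1 (fun t : R => f (t *: v + z)) (0 : R).
  rewrite /derive /=; set F := (X in lim (X @ _) = _).
  set G := (X in _ = lim (X @ _)); suff -> : F = G by [].
  apply/funext => t; rewrite /F /G.
  by rewrite addr0 scale0r add0r [_%:A]mulr1.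
split=> -[d1 d2]; constructor.
- exact: (derivable1P f z v).1.
- by rewrite -E.
- exact: (derivable1P f z v).2.
- by rewrite E.
Qed.

Lemma is_derive_comp1 h f z v dh df :
  is_derive (f z) (1 : R) h dh -> is_derive z v f df ->
  is_derive z v (h \o f) (dh * df).
Proof.
move=> dhf /is_derive_line dfl; apply/is_derive_line.
apply: (is_derive1_comp (f := h)) => //.
by rewrite scale0r add0r.
Qed.

(* A class of functions stable under all ['D_v]: this is how products and
   compositions of smooth functions are shown to be smooth. *)
Inductive smooth_alg : (V -> R) -> Prop :=
| smooth_alg_base f : smooth f -> smooth_alg f
| smooth_alg_add f g : smooth_alg f -> smooth_alg g -> smooth_alg (f \+ g)
| smooth_alg_mul f g : smooth_alg f -> smooth_alg g -> smooth_alg (f \* g)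
| smooth_alg_comp h f : smooth1 h -> smooth_alg f -> smooth_alg (h \o f).

Lemma smooth_derive f v : smooth f -> smooth ('D_v f).
Proof.
move=> sf s; have -> : iter_derive s ('D_v f) = iter_derive (rcons s v) f.
  by rewrite /iter_derive foldr_rcons.
exact: sf.
Qed.

Lemma smooth_alg_derive f : smooth_alg f ->
  [/\ continuous f, forall z v, derivable f z v & forall v, smooth_alg ('D_v f)].
Proof.
elim=> {f} [f sf|f g _ [cf df af] _ [cg dg ag]|f g sf [cf df af] sg [cg dg ag]|
    h f sh sf [cf df af]].
- split; [exact: (sf [::]).1|exact: (sf [::]).2|].
  by move=> v; apply/smooth_alg_base/smooth_derive.
- split=> [z|z v|v]; [by apply: cvgD; [exact: cf|exact: cg]|exact: derivableD|].
  rewrite (_ : 'D_v _ = 'D_v f \+ 'D_v g); first exact: smooth_alg_add.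
  by apply/funext => z; rewrite deriveD.
- split=> [z|z v|v]; [by apply: cvgM; [exact: cf|exact: cg]|exact: derivableM|].
  rewrite (_ : 'D_v _ = (f \* 'D_v g) \+ (g \* 'D_v f)).
    by apply: smooth_alg_add; apply: smooth_alg_mul.
  by apply/funext => z; rewrite deriveM.
- have H z v : is_derive z v (h \o f) (derive1 h (f z) * 'D_v f z).
    by apply: is_derive_comp1; [exact: smooth1_is_derive|exact/derivableP].
  split=> [z|z v|v].
  + by apply: continuous_comp; [exact: cf|exact: smooth1_continuous].
  + exact: ex_derive.
  + rewrite (_ : 'D_v _ = (derive1 h \o f) \* 'D_v f).
      by apply: smooth_alg_mul => //; apply: smooth_alg_comp => //;
        exact: smooth1_derive1.
    by apply/funext => z; rewrite derive_val.
Qed.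

Lemma smooth_algP f : smooth_alg f -> smooth f.
Proof.
move=> sf s; have /smooth_alg_derive[? ? _] : smooth_alg (iter_derive s f) by
  elim: s => //= v s IH; have [_ _] := smooth_alg_derive IH.
by split.
Qed.

Lemma smoothD f g : smooth f -> smooth g -> smooth (f \+ g).
Proof.
by move=> ? ?; apply/smooth_algP/smooth_alg_add; exact/smooth_alg_base.
Qed.

Lemma smoothM f g : smooth f -> smooth g -> smooth (f \* g).
Proof.
by move=> ? ?; apply/smooth_algP/smooth_alg_mul; exact/smooth_alg_base.
Qed.

Lemma smooth_comp1 h f : smooth1 h -> smooth f -> smooth (h \o f).
Proof.
by move=> ? ?; apply/smooth_algP/smooth_alg_comp => //; exact/smooth_alg_base.
Qed.

Lemma smooth_cst (c : R) : smooth (cst c : V -> R).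
Proof.
move=> s; have [d ->] : exists d, iter_derive s (cst c : V -> R) = cst d.
  elim: s => [|v s [d /= ->]]; first by exists c.
  by exists 0; apply/funext => z; rewrite derive_cst.
by split=> [|z v]; [exact: cst_continuous|exact: derivable_cst].
Qed.

Lemma smooth_linear (f : {linear V -> R^o}) : continuous f -> smooth (f : V -> R).
Proof.
move=> cf; have H z v : is_derive z v (f : V -> R^o) (f v).
  have df := linear_differentiable z cf.
  by apply: DeriveDef; [exact: diff_derivable|rewrite deriveE// diff_lin//].
case/lastP=> [|s v]; first by split=> // z v; have [] := H z v.
rewrite /iter_derive foldr_rcons -/(iter_derive _ _).
rewrite (_ : 'D_v _ = cst (f v)); first exact: smooth_cst.
by apply/funext => z; rewrite derive_val.
Qed.

Lemma smooth_sum I (r : seq I) (F : I -> V -> R) :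
  (forall i, smooth (F i)) -> smooth (fun z => \sum_(i <- r) F i z).
Proof.
move=> sF; elim: r => [|i r IH].
  rewrite (_ : (fun _ => _) = cst 0); first exact: smooth_cst.
  by apply/funext => z; rewrite big_nil.
rewrite (_ : (fun _ => _) = F i \+ (fun z => \sum_(j <- r) F j z)).
  exact: smoothD.
by apply/funext => z; rewrite big_cons.
Qed.

Lemma smooth_continuous f : smooth f -> continuous f.
Proof. by move=> sf; exact: (sf [::]).1. Qed.

Lemma smooth_derivable f z v : smooth f -> derivable f z v.
Proof. by move=> sf; exact: (sf [::]).2. Qed.

Lemma smooth_is_derive f z v : smooth f -> is_derive z v f ('D_v f z).
Proof. by move=> sf; exact/derivableP/smooth_derivable. Qed.

End smooth_algebra.


(** * The chain rule along curves *)

Section chain_rule.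
Context {R : realType} {V : normedModType R}.
Implicit Types (f : V -> R).

Lemma is_derive_affine f e y (t : R) : smooth f ->
  is_derive t (1 : R) (fun t : R => f (t *: e + y)) ('D_e f (t *: e + y)).
Proof.
move=> sf.
have := (is_derive_line f (t *: e + y) e _).1 (smooth_is_derive _ e sf).
rewrite (_ : (fun _ => _) =
    (fun h : R => (fun t : R => f (t *: e + y)) (h *: (1 : R^o) + t))).
  exact: (is_derive_line (fun t : R^o => f (t *: e + y)) t 1 _).2.
by apply/funext => h; rewrite addrA -scalerDl [h *: (1 : R)]mulr1.
Qed.

(** The intermediate point is only bounded by [|a|]: this covers both signs of [a] and suffices for
    a squeeze as [a] tends to 0. *)
Lemma mvt_line f e y (a : R) : smooth f ->
  exists2 th, `|th| <= `|a| & f (a *: e + y) - f y = a * 'D_e f (th *: e + y).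
Proof.
move=> sf; pose g (t : R) := f (t *: e + y).
have dg t : is_derive t (1 : R) g ('D_e f (t *: e + y)) by exact: is_derive_affine.
have cg (A : set R) : {within A, continuous g}.
  apply: continuous_subspaceT => t.
  exact/differentiable_continuous/derivable1_diffP/ex_derive.
have g0 : f y = g 0 by rewrite /g scale0r add0r.
have [a0|a0] := leP 0 a.
- have [th] := MVT_segment a0 (fun x _ => dg x) (cg _).
  rewrite in_itv/= => /andP[th0 tha] E; exists th.
    by rewrite !ger0_norm.
  by rewrite g0 [LHS]E subr0 mulrC.
- have [th] := MVT_segment (ltW a0) (fun x _ => dg x) (cg _).
  rewrite in_itv/= => /andP[th0 tha] E; exists th.
    by rewrite (ltr0_norm a0) (ler0_norm tha) lerN2.
  by rewrite g0 -[LHS]opprB [in LHS]E sub0r mulrN opprK mulrC.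
Qed.

Lemma cvg_seq_sum T (F : set_system T) (FF : Filter F) I (r : seq I) (g : I -> T -> V)
    (l : I -> V) :
  (forall i, g i @ F --> l i) -> \sum_(i <- r) g i t @[t --> F] --> \sum_(i <- r) l i.
Proof.
move=> gl; elim: r => [|i r IH].
  rewrite big_nil (_ : (fun _ => _) = cst 0); first exact: cvg_cst.
  by apply/funext => t; rewrite big_nil.
rewrite big_cons (_ : (fun _ => _) = g i \+ (fun t => \sum_(j <- r) g j t)).
  exact: cvgD (gl i) IH.
by apply/funext => t; rewrite big_cons.
Qed.

(* The displacement is split into its components, the mean value theorem being applied
   to one direction at a time, so that no Frechet derivative is needed. *)
Lemma is_derive_curve0 f (I : Type) (r : seq I) (e : I -> V) (c : I -> R -> R)
    (dc : I -> R) (s0 : R) z : smooth f ->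
  (forall i, is_derive s0 (1 : R) (c i) (dc i)) ->
  is_derive s0 (1 : R) (fun s => f (\sum_(i <- r) (c i s - c i s0) *: e i + z))
    (\sum_(i <- r) dc i * 'D_(e i) f z).
Proof.
move=> sf dcP; elim: r => [|i r IH].
  rewrite big_nil; rewrite (_ : (fun _ => _) = cst (f z)).
    exact: is_derive_cst.
  by apply/funext => s; rewrite big_nil add0r.
have /is_derive1_caratheodory[g [gE cg g0]] := IH.
have /is_derive1_caratheodory[A [AE cA A0]] := dcP i.
pose w s := \sum_(j <- r) (c j s - c j s0) *: e j + z.
have cc j : c j s @[s --> s0] --> c j s0.
  by apply/differentiable_continuous/derivable1_diffP/(ex_derive (is_derive := dcP j)).
have cd j : c j s - c j s0 @[s --> s0] --> (0 : R).
  by rewrite -[X in _ --> X](subrr (c j s0)); apply: cvgB; [exact: cc|exact: cvg_cst].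
have cw : w s @[s --> s0] --> z.
  rewrite -[X in _ --> X]add0r; apply: cvgD; last exact: cvg_cst.
  rewrite [X in _ --> X](_ : 0 = \sum_(j <- r) (0 : V)); last by rewrite big1.
  apply: cvg_seq_sum => j; rewrite -[X in _ --> X](scale0r (e j)).
  exact: cvgZr_tmp (cd j).
(* The intermediate points are chosen for each [s] separately, with no continuity; the bound by the
   displacement alone forces [th s] to 0. *)
have /choice[th thP] : forall s, exists t : R, `|t| <= `|c i s - c i s0| /\
    f ((c i s - c i s0) *: e i + w s) - f (w s) =
    (c i s - c i s0) * 'D_(e i) f (t *: e i + w s).
  by move=> s; have [t ? ?] := mvt_line (e i) (w s) (c i s - c i s0) sf; exists t.
have cth : th s @[s --> s0] --> (0 : R).
  apply: norm_cvg0; have ca : `|c i s - c i s0| @[s --> s0] --> (0 : R).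
    by rewrite -[X in _ --> X](normr0 R); apply: cvg_norm; exact: cd.
  apply: (squeeze_cvgr _ (cvg_cst 0) ca).
  by apply: nearW => s; rewrite normr_ge0 (thP s).1.
have thz : th s0 = 0.
  by apply/eqP; rewrite -normr_le0 (le_trans (thP s0).1)// subrr normr0.
have w0 : w s0 = z.
  by rewrite /w big1 ?add0r// => j _; rewrite subrr scale0r.
apply/is_derive1_caratheodory.
(* The Caratheodory slope of the full curve: the slope [A] of [c i] times the derivative at the
   intermediate point, plus the slope [g] of the remaining directions. *)
exists (fun s => A s * 'D_(e i) f (th s *: e i + w s) + g s); split.
- move=> s; rewrite mulrDl -gE mulrAC -AE -(thP s).2 -/(w s) -/(w s0) w0.
  rewrite [X in f (X + z) - _]big_cons [X in _ - f (X + z)]big_cons -!addrA.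
  rewrite -/(w s) -/(w s0) subrr scale0r add0r w0.
  by rewrite addKr.
- have cp : th s *: e i + w s @[s --> s0] --> z.
    rewrite -[X in _ --> X]add0r; apply: cvgD => //.
    by rewrite -[X in _ --> X](scale0r (e i)); exact: cvgZr_tmp.
  have H : A s * 'D_(e i) f (th s *: e i + w s) + g s @[s --> s0] -->
      A s0 * 'D_(e i) f z + g s0.
    apply: cvgD => //; apply: cvgM => //.
    exact: (cvg_comp _ _ cp (smooth_continuous (smooth_derive (e i) sf) (x:=z))).
  have E : th s0 *: e i + w s0 = z by rewrite thz w0 scale0r add0r.
  by rewrite -{1}E in H; exact: H.
- by rewrite thz w0 scale0r add0r A0 g0 big_cons.
Qed.

Lemma is_derive_curve f (I : Type) (r : seq I) (e : I -> V) (c : I -> R -> R)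
    (dc : I -> R) (s0 : R) : smooth f ->
  (forall i, is_derive s0 (1 : R) (c i) (dc i)) ->
  is_derive s0 (1 : R) (fun s => f (\sum_(i <- r) c i s *: e i))
    (\sum_(i <- r) dc i * 'D_(e i) f (\sum_(i <- r) c i s0 *: e i)).
Proof.
move=> sf dcP; have := is_derive_curve0 r e (\sum_(i <- r) c i s0 *: e i) sf dcP.
congr is_derive; apply/funext => s; rewrite -big_split/=; congr f.
by apply: eq_bigr => i _; rewrite -scalerDl subrK.
Qed.

End chain_rule.


(** * The Euler field and the radial operators *)

Section euler_field.
Context {R : realType} {n : nat}.
Local Notation G := (@grushin R n).
Implicit Types (u w : G -> R) (z : G).

Definition xdir (i : 'I_n) : G := (delta_mx ord0 i, 0).
Definition tdir : G := (0, 1).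

Definition euler u z : R :=
  \sum_(i < n) z.1 ord0 i * 'D_(xdir i) u z + 2 * z.2 * 'D_tdir u z.

Definition dilation (s : R) z : G := (expR s *: z.1, expR (2 * s) * z.2).

Lemma smooth_x i : smooth (fun z => z.1 ord0 i).
Proof.
pose f (z : G) : R^o := z.1 ord0 i.
have lf : linear f by move=> a x y; rewrite /f /= !mxE.
pose F : {linear G -> R^o} := HB.pack f (GRing.isLinear.Build _ _ _ _ f lf).
apply: (smooth_linear (f := F)) => z.
by apply: (@continuous_comp _ _ _ fst (fun x : 'rV[R]_n => x ord0 i));
  [exact: cvg_fst|exact: coord_continuous].
Qed.

Lemma smooth_t : smooth (fun z => z.2).
Proof.
pose f (z : G) : R^o := z.2.
have lf : linear f by move=> a x y.
pose F : {linear G -> R^o} := HB.pack f (GRing.isLinear.Build _ _ _ _ f lf).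
by apply: (smooth_linear (f := F)) => z; exact: cvg_snd.
Qed.

Lemma smooth_euler u : smooth u -> smooth (euler u).
Proof.
move=> su; rewrite (_ : euler u =
    (fun z => \sum_(i <- index_enum 'I_n) z.1 ord0 i * 'D_(xdir i) u z) \+
    ((cst 2 \* (fun z => z.2)) \* 'D_tdir u)) //.
apply: smoothD; last first.
  apply: smoothM; last exact: smooth_derive.
  by apply: smoothM; [exact: smooth_cst|exact: smooth_t].
apply: (@smooth_sum _ _ _ _ (fun i z => z.1 ord0 i * 'D_(xdir i) u z)) => i.
by apply: smoothM; [exact: smooth_x|exact: smooth_derive].
Qed.

(** Writes points, and so dilation orbits, with scalar coefficients along fixed directions, the form
    that [is_derive_curve] takes; the rounding to a grid uses it too. *)
Lemma grushin_decomp z :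
  z = \sum_(i < n) z.1 ord0 i *: xdir i + z.2 *: tdir.
Proof.
case: z => x t /=.
set S := \sum_(i < n) _.
have S1 : S.1 = x.
  rewrite /S (big_morph fst (fun a b => erefl) erefl) [RHS]row_sum_delta.
  by apply: eq_bigr => i _.
have S2 : S.2 = 0.
  rewrite /S (big_morph snd (fun a b => erefl) erefl) big1// => i _.
  exact: mulr0.
case: S S1 S2 => _ _ /= -> ->; congr pair; rewrite /=.
  by rewrite scaler0 addr0.
by rewrite add0r [_ *: _]mulr1.
Qed.

Lemma is_derive_dilation u z (s : R) : smooth u ->
  is_derive s (1 : R) (fun s => u (dilation s z)) (euler u (dilation s z)).
Proof.
move=> su.
(* [None] stands for the [t] direction, so that all directions form a single sequence. *)
pose r := None :: [seq Some i | i <- index_enum 'I_n].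
pose e (o : option 'I_n) : G := if o is Some i then xdir i else tdir.
pose c (o : option 'I_n) (s : R) : R :=
  if o is Some i then expR s * z.1 ord0 i else expR (2 * s) * z.2.
pose dc (o : option 'I_n) : R :=
  if o is Some i then expR s * z.1 ord0 i else 2 * (expR (2 * s) * z.2).
have cE s0 : dilation s0 z = \sum_(o <- r) c o s0 *: e o.
  rewrite big_cons big_map addrC [LHS]grushin_decomp /=.
  by congr (_ + _); apply: eq_bigr => i _; rewrite mxE.
have dcE : forall o, is_derive s (1 : R) (c o) (dc o).
  case=> [i|] /=.
    by apply: is_derive_eq; rewrite scaler0 add0r mulrC.
  have E a b : b *: (a * 2%:A) = 2 * (a * b) :> R.
    by rewrite [2%:A]mulr1 [LHS]mulrC mulrAC mulrC.
  by apply: is_derive_eq; rewrite scaler0 add0r E.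
have := is_derive_curve r e su dcE.
rewrite -cE (_ : \sum_(o <- r) _ = euler u (dilation s z)).
  by congr is_derive; apply/funext => s0; rewrite -cE.
rewrite /r big_cons big_map addrC; congr (_ + _).
  by apply: eq_bigr => i _; rewrite /= mxE.
Qed.

End euler_field.


Section test_functions.
Context {R : realType} {V : normedModType R}.
Implicit Types f g : V -> R.

(** Meant for [g] obtained from [f] by a differential operator, which is local and so cannot enlarge
    the support. *)
Lemma compactly_supported_local f g :
  (forall z, (\near z, f z = 0) -> g z = 0) ->
  compactly_supported f -> compactly_supported g.
Proof.
move=> fg cf; apply: (subclosed_compact _ cf); first exact: closed_closure.
rewrite [X in _ `<=` X](closure_id _).1; last exact: closed_closure.
apply: closureS => z /= gz B Bz; apply: contrapT => fB.
move: gz; rewrite fg ?eqxx//; apply: filterS Bz => y By.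
by apply: contrapT => /eqP fy; apply: fB; exists y.
Qed.

End test_functions.

Section radial.
Context {R : realType} {n : nat}.
Local Notation G := (@grushin R n).
Local Notation Q := (@hdim R n).
Implicit Types (u w : G -> R) (z : G).

(** [sqn] and [gauge] are [|x|^2] and [rho^4]. Being polynomials they are smooth at the origin too,
    and every real power below is a power of [gauge]. *)
Definition sqn z : R := \sum_(i < n) z.1 ord0 i ^+ 2.
Definition gauge z : R := sqn z ^+ 2 + 4 * z.2 ^+ 2.

Lemma sqn_ge0 z : 0 <= sqn z.
Proof. by apply: sumr_ge0 => i _; exact: sqr_ge0. Qed.

Lemma gauge_ge0 z : 0 <= gauge z.
Proof. by apply: addr_ge0; [exact: sqr_ge0|apply: mulr_ge0 => //; exact: sqr_ge0]. Qed.

Lemma enorm2 z : enorm z.1 ^+ 2 = sqn z.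
Proof. by rewrite sqr_sqrtr// sqn_ge0. Qed.

Lemma rhoE z : rho z = gauge z `^ (4^-1).
Proof. by rewrite /rho (exprM _ 2 2) enorm2. Qed.

Lemma psiE z : psi z = sqn z / gauge z `^ (2^-1).
Proof.
rewrite /psi enorm2 rhoE -powR_mulrn ?powR_ge0// -powRrM; congr (_ / _ `^ _).
by field.
Qed.

Lemma gauge_eq0 z : gauge z = 0 -> z = 0.
Proof.
move/eqP; rewrite paddr_eq0 ?sqr_ge0//; last by apply: mulr_ge0 => //; exact: sqr_ge0.
move=> /andP[].
rewrite expf_eq0/= mulf_eq0 expf_eq0/= pnatr_eq0/= => /eqP s0 /eqP t0.
case: z s0 t0 => x t /= s0 ->; congr pair; apply/rowP => i; rewrite mxE.
have /eqP := s0; rewrite psumr_eq0 => [|j _]; last exact: sqr_ge0.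
by move=> /allP/(_ i (mem_index_enum _))/=; rewrite expf_eq0/= => /eqP.
Qed.

Lemma gauge_gt0 z : z != 0 -> 0 < gauge z.
Proof.
by move=> z0; rewrite lt0r gauge_ge0 andbT; apply: contra z0 => /eqP/gauge_eq0 ->.
Qed.

Lemma smooth_sqn : smooth sqn.
Proof.
apply: (@smooth_sum _ _ _ _ (fun i (z : G) => z.1 ord0 i ^+ 2)) => i.
rewrite (_ : (fun _ => _) = (fun z : G => z.1 ord0 i) \* (fun z : G => z.1 ord0 i)).
  by apply: smoothM; exact: smooth_x.
by apply/funext => z; rewrite expr2.
Qed.

Lemma smooth_gauge : smooth gauge.
Proof.
rewrite (_ : gauge = (sqn \* sqn) \+ (cst 4 \* ((fun z : G => z.2) \* (fun z : G => z.2)))).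
  apply: smoothD; first by apply: smoothM; exact: smooth_sqn.
  by apply: smoothM; [exact: smooth_cst|apply: smoothM; exact: smooth_t].
by apply/funext => z; rewrite /gauge !expr2.
Qed.

Lemma sqn_dilation s z : sqn (dilation s z) = expR (2 * s) * sqn z.
Proof.
rewrite /sqn mulr_sumr; apply: eq_bigr => i _.
by rewrite mxE exprMn -expRM_natl.
Qed.

Lemma gauge_dilation s z : gauge (dilation s z) = expR (4 * s) * gauge z.
Proof.
rewrite /gauge sqn_dilation /= !exprMn -!expRM_natl mulrDr; congr (_ + _).
  by congr (expR _ * _); ring.
by rewrite mulrCA; congr (expR _ * _); ring.
Qed.

Lemma dilation0 z : dilation 0 z = z.
Proof. by case: z => x t; rewrite /dilation mulr0 expR0 scale1r mul1r. Qed.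

(** Computes [Z u] by differentiating along the orbit instead of summing partial derivatives; for
    homogeneous [u] this only differentiates an exponential. *)
Lemma euler_is_derive u z d : smooth u ->
  is_derive (0 : R) (1 : R) (fun s => u (dilation s z)) d -> euler u z = d.
Proof.
move=> su [_ <-]; have [_] := is_derive_dilation z 0 su.
by rewrite dilation0.
Qed.

Lemma euler_gauge z : euler gauge z = 4 * gauge z.
Proof.
apply: euler_is_derive smooth_gauge _.
rewrite (_ : (fun _ => _) = fun s : R => expR (4 * s) * gauge z); last first.
  by apply/funext => s; rewrite gauge_dilation.
by apply: is_derive_eq; rewrite mulr0 expR0 scaler0 add0r mul1r [_%:A]mulr1 [LHS]mulrC.
Qed.

Lemma near_eq_euler u w z : (\near z, u z = w z) -> euler u z = euler w z.
Proof.
move=> uw; rewrite /euler; congr (_ + _ * _); last exact: near_eq_derive.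
by apply: eq_bigr => i _; congr (_ * _); exact: near_eq_derive.
Qed.

Lemma near_gauge_gt0 z : 0 < gauge z -> \near z, 0 < gauge z.
Proof.
move=> gz; have cg : {for z, continuous gauge} by exact/smooth_continuous/smooth_gauge.
exact: (cvgr_gt _ cg).
Qed.

Lemma is_derive_gauge_pow c w z v : smooth w -> 0 < gauge z ->
  is_derive z v (fun z => gauge z `^ c * w z)
    (gauge z `^ c * 'D_v w z + w z * (c * gauge z `^ (c - 1) * 'D_v gauge z)).
Proof.
move=> sw gz.
have H : is_derive z v (fun z => gauge z `^ c) (c * gauge z `^ (c - 1) * 'D_v gauge z).
  apply: (is_derive_comp1 (h := fun x => x `^ c)).
    exact: is_derive1_powR.
  exact/smooth_is_derive/smooth_gauge.
by have := is_deriveM H (smooth_is_derive z v sw).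
Qed.

(** Leibniz together with Euler's identity for [gauge ^ c], of degree [4 c]. The product may be
    singular at the origin, so [euler_is_derive] does not apply and the partial derivatives are
    used. *)
Lemma euler_gauge_pow c w z : smooth w -> 0 < gauge z ->
  euler (fun z => gauge z `^ c * w z) z =
    gauge z `^ c * (4 * c * w z + euler w z).
Proof.
move=> sw gz.
have dE v : 'D_v (fun z => gauge z `^ c * w z) z =
    (gauge z `^ c) * 'D_v w z + (w z * c * gauge z `^ (c - 1)) * 'D_v gauge z.
  by rewrite (derive_val (is_derive := is_derive_gauge_pow c v sw gz)) !mulrA.
rewrite /euler dE (eq_bigr (fun i => gauge z `^ c * (z.1 ord0 i * 'D_(xdir i) w z) +
    (w z * c * gauge z `^ (c - 1)) * (z.1 ord0 i * 'D_(xdir i) gauge z))); last first.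
  by move=> i _; rewrite dE; ring.
rewrite big_split/= -!mulr_sumr.
have := euler_gauge z; rewrite /euler.
set A := \sum_(i < n) _ * 'D_(xdir i) gauge z.
move=> /(canRL (addrK _)) ->.
have -> : gauge z `^ c = gauge z `^ (c - 1) * gauge z.
  by rewrite -{3}(powRr1 (gauge_ge0 z)) -powRD ?subrK// (gt_eqF gz) implybT.
by ring.
Qed.

Lemma euler_sqn_pow l w z : smooth w ->
  euler (fun z => sqn z ^+ l * w z) z = sqn z ^+ l * (2 * l%:R * w z + euler w z).
Proof.
move=> sw; apply: euler_is_derive.
  elim: l => [|l IH]; first by under eq_fun do rewrite expr0 mul1r.
  under eq_fun do rewrite exprS -mulrA.
  by apply: smoothM => //; exact: smooth_sqn.
rewrite (_ : (fun _ => _) =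
    fun s : R => expR (2 * l%:R * s) * (sqn z ^+ l * w (dilation s z))); last first.
  apply/funext => s; rewrite sqn_dilation exprMn -expRM_natl [RHS]mulrA.
  by congr (expR _ * _ * _); ring.
have dw : is_derive (0 : R) (1 : R) (fun s => w (dilation s z)) (euler w z).
  by have := is_derive_dilation z 0 sw; rewrite dilation0.
by apply: is_derive_eq; rewrite dilation0 mulr0 expR0 /GRing.scale/=; ring.
Qed.

End radial.


Lemma gt0_powRD {R : realType} (x r s : R) : 0 < x -> x `^ (r + s) = x `^ r * x `^ s.
Proof. by move=> x0; rewrite powRD// (gt_eqF x0) implybT. Qed.

Section radial_operators.
Context {R : realType} {n : nat}.
Local Notation G := (@grushin R n).
Local Notation Q := (@hdim R n).
Implicit Types (u v w : G -> R) (z : G).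

Definition shifted_euler (c : R) u z : R := euler u z + c * u z.

(* [radial_lap] iterated [l] times is [(psi / rho ^ 2) ^ l * radial_symbol l]. *)
Fixpoint radial_symbol (l : nat) u : G -> R :=
  if l is m.+1 then
    shifted_euler (Q - 2 - 2 * m%:R) (shifted_euler (- 2 * m%:R) (radial_symbol m u))
  else u.

Lemma smooth_shifted_euler c u : smooth u -> smooth (shifted_euler c u).
Proof.
move=> su; rewrite (_ : shifted_euler c u = euler u \+ (cst c \* u)); last by [].
apply: smoothD; first exact: smooth_euler.
by apply: smoothM su; exact: smooth_cst.
Qed.

Lemma smooth_radial_symbol l u : smooth u -> smooth (radial_symbol l u).
Proof.
by move=> su; elim: l => [|l IH]; [exact: su|do 2 apply: smooth_shifted_euler; exact: IH].
Qed.

Lemma compactly_supported_shifted_euler c u :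
  compactly_supported u -> compactly_supported (shifted_euler c u).
Proof.
apply: compactly_supported_local => z u0.
have D0 (v : G) : 'D_v u z = 0.
  rewrite (near_eq_derive (g := cst 0))//; last exact: derive_cst.
rewrite /shifted_euler (nbhs_singleton u0) mulr0 addr0 /euler D0 mulr0 addr0.
by rewrite big1// => i _; rewrite D0 mulr0.
Qed.

Lemma test_function_shifted_euler c u : test_function u -> test_function (shifted_euler c u).
Proof.
by move=> [? ?]; split; [exact: smooth_shifted_euler|exact: compactly_supported_shifted_euler].
Qed.

Lemma partial_rhoE u z : partial_rho u z = (rho z)^-1 * euler u z.
Proof. by []. Qed.

Lemma smooth_sqnX l u : smooth u -> smooth (fun z : G => sqn z ^+ l * u z).
Proof.
move=> su; elim: l => [|l IH]; first by under eq_fun do rewrite expr0 mul1r.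
under eq_fun do rewrite exprS -mulrA.
by apply: smoothM IH; exact: smooth_sqn.
Qed.

(** The prefactor has degree [4 c + 2 l], which becomes the shift of [Z], and [rho^-1] lowers the
    exponent of [gauge] by 1/4. The formula for [f] is assumed only near [z], as it may fail at the
    origin. *)
Lemma partial_rho_homog f c l v z : smooth v -> 0 < gauge z ->
  (\near z, f z = gauge z `^ c * (sqn z ^+ l * v z)) ->
  partial_rho f z =
    gauge z `^ (c - 4^-1) * (sqn z ^+ l * shifted_euler (4 * c + 2 * l%:R) v z).
Proof.
move=> sv gz fE; rewrite partial_rhoE (near_eq_euler fE).
rewrite (euler_gauge_pow _ (smooth_sqnX l sv) gz) (euler_sqn_pow _ _ sv).
rewrite rhoE -powRN gt0_powRD// /shifted_euler.
by ring.
Qed.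

(** The prefactor is [(psi / rho^2)^l], of degree [-2 l]. The first [d_rho] gives the shift [-2 l];
    the second sees degree [-2 l - 1], and the term [(Q - 1) / rho] raises its shift to
    [Q - 2 - 2 l]. *)
Lemma iter_radial_lap l u z : smooth u -> 0 < gauge z ->
  iter l radial_lap u z = gauge z `^ (- l%:R) * (sqn z ^+ l * radial_symbol l u z).
Proof.
move=> su; elim: l z => [|l IH] z gz; first by rewrite oppr0 powRr0 !mul1r.
have nl z' : 0 < gauge z' -> \near z', iter l radial_lap u z' =
    gauge z' `^ (- l%:R) * (sqn z' ^+ l * radial_symbol l u z').
  by move=> /near_gauge_gt0; apply: filterS.
have sl := smooth_radial_symbol l su.
have nl1 z' : 0 < gauge z' -> partial_rho (iter l radial_lap u) z' =
    gauge z' `^ (- l%:R - 4^-1) *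
      (sqn z' ^+ l * shifted_euler (- 2 * l%:R) (radial_symbol l u) z').
  move=> gz'; rewrite (partial_rho_homog sl gz' (nl _ gz')).
  by congr (_ * (_ * shifted_euler _ _ _)); ring.
rewrite iterS /radial_lap nl1//.
rewrite (@partial_rho_homog _ (- l%:R - 4^-1) l
  (shifted_euler (- 2 * l%:R) (radial_symbol l u)) z
  (smooth_shifted_euler _ sl) gz); last first.
  by move/near_gauge_gt0 : gz; apply: filterS => z'; exact: nl1.
have -> : radial_symbol l.+1 u = shifted_euler (Q - 2 - 2 * l%:R)
  (shifted_euler (- 2 * l%:R) (radial_symbol l u)) by [].
set v := shifted_euler (- 2 * l%:R) _.
rewrite psiE rhoE exprS /shifted_euler.
have -> : gauge z `^ (- l%:R - 4^-1 - 4^-1) = gauge z `^ (- l%:R - 2^-1).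
  by congr (_ `^ _); field.
have -> : gauge z `^ (- l.+1%:R) = gauge z `^ (- 2^-1) * gauge z `^ (- l%:R - 2^-1).
  by rewrite -gt0_powRD//; congr (_ `^ _); rewrite -natr1; field.
have -> : gauge z `^ (- l%:R - 2^-1) = gauge z `^ (- 4^-1) * gauge z `^ (- l%:R - 4^-1).
  by rewrite -gt0_powRD//; congr (_ `^ _); field.
rewrite -!powRN.
by rewrite /hdim; set E := euler _ z; field.
Qed.

End radial_operators.


(** * The inequality on a line *)

Section normed_power.
Context {R : realType}.
Implicit Types (p r x y : R).

(** The odd power; for [r = p - 1] it is the derivative of [|x|^p / p]. *)
Definition sgpow r x : R := Num.sg x * `|x| `^ r.

(** At [x = 0] the sign vanishes, whereas zero to the power zero is 1; hence [r != 0]. *)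
Lemma norm_sgpow r x : r != 0 -> `|sgpow r x| = `|x| `^ r.
Proof.
move=> r0; rewrite normrM (ger0_norm (powR_ge0 _ _)) normr_sg.
by have [->|x0] := eqVneq x 0; rewrite ?mul1r// normr0 powR0// mulr0.
Qed.

Lemma continuous_norm_powR r : 0 < r -> continuous (fun x : R => `|x| `^ r).
Proof.
move=> r0 x; have [->|x0] := eqVneq x 0; last first.
  apply: (@continuous_comp _ _ _ (fun x : R => `|x|) (fun y => y `^ r)).
    exact: norm_continuous.
  apply/differentiable_continuous/derivable1_diffP/derivable_powR.
  by rewrite in_itv/= normr_gt0 x0.
rewrite /continuous_at normr0 powR0 ?gt_eqF//; apply/cvgr0Pnorm_lt => e e0.
have d0 : 0 < e `^ r^-1 by exact: powR_gt0.
near=> z; rewrite ger0_norm ?powR_ge0//.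
rewrite -[ltRHS]powRr1 ?ltW// -(mulVf (lt0r_neq0 r0)) powRrM.
apply: gt0_ltr_powR; rewrite ?nnegrE ?powR_ge0//.
Unshelve. all: by end_near. Qed.

Lemma near_sg x : x != 0 -> \forall y \near x, Num.sg y = Num.sg x.
Proof.
move=> x0; have [x_gt0|x_lt0|/eqP] := ltgtP x 0; last by rewrite (negPf x0).
- near=> y; rewrite (ltr0_sg x_gt0) ltr0_sg//; near: y.
  exact: lt_nbhsl.
- near=> y; rewrite (gtr0_sg x_lt0) gtr0_sg//; near: y.
  exact: lt_nbhsr.
Unshelve. all: by end_near. Qed.

Lemma continuous_sgpow r : 0 < r -> continuous (sgpow r).
Proof.
move=> r0 x; have [->|x0] := eqVneq x 0; last first.
  have H : {for x, continuous (fun y : R => Num.sg x * `|y| `^ r)}.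
    by apply: cvgM; [exact: cvg_cst|exact: continuous_norm_powR].
  apply: cvg_trans H; apply: near_eq_cvg.
  by near=> y; rewrite /sgpow (near (near_sg x0) y).
rewrite /continuous_at {2}/sgpow sgr0 mul0r; apply: norm_cvg0.
under eq_cvg do rewrite norm_sgpow ?gt_eqF//.
by have := continuous_norm_powR r0 (x := 0); rewrite /continuous_at normr0 powR0 ?gt_eqF.
Unshelve. all: by end_near. Qed.

(** Away from 0 the sign is locally constant and [|y|] is [sg x * y]. At 0 the slope function is
    [sgpow (p - 1)] itself, continuous there because [p > 1]. *)
Lemma is_derive_norm_powR p x : 1 < p ->
  is_derive x (1 : R) (fun x : R => `|x| `^ p) (p * sgpow (p - 1) x).
Proof.
move=> p1; have p0 : 0 < p by exact: lt_trans p1.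
have p10 : 0 < p - 1 by rewrite subr_gt0.
have [->|x0] := eqVneq x 0.
  apply/is_derive1_caratheodory; exists (sgpow (p - 1)); split.
  - move=> z; rewrite normr0 powR0 ?gt_eqF// !subr0 /sgpow mulrAC -normrEsg.
    by rewrite mulr_powRB1.
  - exact: continuous_sgpow.
  - by rewrite /sgpow sgr0 !mul0r mulr0.
have H : is_derive x (1 : R) (fun y : R => (Num.sg x * y) `^ p)
    (p * (Num.sg x * x) `^ (p - 1) * Num.sg x).
  apply: (is_derive1_comp (f := fun y => y `^ p) (g := fun y => Num.sg x * y)).
    by apply: is_derive1_powR; rewrite -normrEsg normr_gt0.
  by apply: is_derive_eq; exact: mulr1.
rewrite (_ : p * _ = p * (Num.sg x * x) `^ (p - 1) * Num.sg x); last first.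
  by rewrite /sgpow normrEsg; ring.
apply: near_eq_is_derive H.
by near=> y; rewrite [in RHS]normrEsg (near (near_sg x0) y).
Unshelve. all: by end_near. Qed.

(** The tangent inequality is Young's inequality for [|y|] and [|x|^(p-1)] with exponents [p] and
    [q = p / (p - 1)], since [sgpow (p - 1) x * x = |x|^p]. *)
Lemma norm_powR_convex p x y : 1 < p ->
  `|x| `^ p + p * sgpow (p - 1) x * (y - x) <= `|y| `^ p.
Proof.
move=> p1; have p0 : 0 < p by exact: lt_trans p1.
have p10 : 0 < p - 1 by rewrite subr_gt0.
pose q := p / (p - 1); have pn0 := lt0r_neq0 p0.
have q0 : 0 < q by rewrite divr_gt0.
have pq : p^-1 + q^-1 = 1 by rewrite /q invf_div -[X in X + _]mul1r -mulrDl addrC subrK divff// gt_eqF.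
have := conjugate_powR (normr_ge0 y) (powR_ge0 `|x| (p - 1)) p0 q0 pq.
rewrite -powRrM (_ : (p - 1) * q = p); last by rewrite /q mulrC divfK// gt_eqF.
move=> yx; have xx : sgpow (p - 1) x * x = `|x| `^ p.
  by rewrite /sgpow mulrAC -normrEsg mulr_powRB1.
have xy : sgpow (p - 1) x * y <= `|y| * `|x| `^ (p - 1).
  by rewrite (le_trans (ler_norm _))// normrM norm_sgpow ?gt_eqF// mulrC.
have H : p * (sgpow (p - 1) x * y) <= `|y| `^ p + (p - 1) * `|x| `^ p.
  have -> : `|y| `^ p + (p - 1) * `|x| `^ p = p * (`|y| `^ p / p + `|x| `^ p / q).
    by rewrite /q invf_div; field.
  by rewrite ler_pM2l//; exact: le_trans xy yx.
rewrite -mulrA mulrBr xx; lra.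
Qed.

End normed_power.


Section one_dimensional_hardy.
Context {R : realType}.
Local Notation mu := (@lebesgue_measure R).
Variables (p a : R) (g g' : R -> R).
Hypotheses (p1 : 1 < p) (dg : forall s : R, is_derive s (1 : R) g (g' s)).
Hypotheses (cg' : continuous g').

Let p0 : 0 < p. Proof. exact: lt_trans p1. Qed.

Let cg : continuous g.
Proof.
move=> s; apply/differentiable_continuous/derivable1_diffP.
exact: (ex_derive (is_derive := dg s)).
Qed.

Let K s := `|g s| `^ p.
Let F s := `|g' s + a * g s| `^ p.
Let K' s := p * sgpow (p - 1) (g s) * g' s.
Let A := sgpow (p - 1) a.

Let cK : continuous K.
Proof.
by move=> s; apply: (@continuous_comp _ _ _ g (fun x => `|x| `^ p));
  [exact: cg|exact: continuous_norm_powR].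
Qed.

Let cF : continuous F.
Proof.
move=> s; apply: (@continuous_comp _ _ _ (fun s => g' s + a * g s) (fun x => `|x| `^ p)).
  by apply: cvgD; [exact: cg'|apply: cvgM; [exact: cvg_cst|exact: cg]].
exact: continuous_norm_powR.
Qed.

Let cK' : continuous K'.
Proof.
move=> s; apply: cvgM; last exact: cg'.
apply: cvgM; first exact: cvg_cst.
apply: (@continuous_comp _ _ _ g (sgpow (p - 1))); first exact: cg.
by apply: continuous_sgpow; rewrite subr_gt0.
Qed.

Let dK (s : R) : is_derive s (1 : R) K (K' s).
Proof.
exact: (is_derive1_comp (f := fun x => `|x| `^ p)) (is_derive_norm_powR _ p1) (dg s).
Qed.

Let pointwise s : `|a| `^ p * K s + A * K' s <= F s.
Proof.
have -> : A * K' s = p * sgpow (p - 1) (a * g s) * g' s.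
  by rewrite /A /K' /sgpow sgrM normrM powRM//; ring.
rewrite /K -powRM// -normrM (le_trans _ (norm_powR_convex (a * g s) _ p1))//.
by rewrite addrK.
Qed.

Let integrable_itv (f : R -> R) (x y : R) : continuous f ->
  mu.-integrable `[x, y] (EFin \o f).
Proof.
move=> cf; apply: continuous_compact_integrable; first exact: segment_compact.
exact: continuous_subspaceT.
Qed.

(** The pointwise bound integrated over a segment: the total derivative leaves boundary terms, and
    the nonnegative right side is extended to the whole line. *)
Let segment_bound (x y : R) : x < y ->
  ((`|a| `^ p)%:E * \int[mu]_(s in `[x, y]) (K s)%:E + (A * (K y - K x))%:E
    <= \int[mu]_s (F s)%:E)%E.
Proof.
move=> xy.
have FTC : (\int[mu]_(s in `[x, y]) (K' s)%:E = (K y - K x)%:E)%E.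
  apply: continuous_FTC2 => //; first exact: continuous_subspaceT.
    split => [s _|//|//].
    + exact: (ex_derive (is_derive := dK s)).
    + exact/cvg_at_right_filter/cK.
    + exact/cvg_at_left_filter/cK.
  by move=> s _; rewrite derive1E (derive_val (is_derive := dK s)).
rewrite EFinM -FTC -!integralZl//; [|exact: integrable_itv..].
rewrite -integralD//; last 2 first.
- by apply: integrableZl => //; exact: integrable_itv.
- by apply: integrableZl => //; exact: integrable_itv.
apply: (@le_trans _ _ (\int[mu]_(s in `[x, y]) (F s)%:E)%E).
  apply: le_integral => //.
  - by apply: integrableD => //; apply: integrableZl => //; exact: integrable_itv.
  - exact: integrable_itv.
  - by move=> s _; rewrite -!EFinM -EFinD lee_fin.
apply: ge0_subset_integral => //.
- by apply/measurable_EFinP; exact: continuous_measurable_fun.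
- by move=> s _; rewrite lee_fin powR_ge0.
Qed.

Lemma hardy_line (M : R) : g x @[x --> -oo] --> 0 -> (forall s, M <= s -> g s = 0) ->
  ((`|a| `^ p)%:E * \int[mu]_s (`|g s| `^ p)%:E <= \int[mu]_s (`|g' s + a * g s| `^ p)%:E)%E.
Proof.
move=> g0 gM.
pose S (m : nat) := `[(- m%:R : R), m%:R]%classic.
have US : \bigcup_m S m = setT.
  rewrite -subTset => s _; exists (Num.bound `|s|) => //; rewrite /S /=.
  by rewrite in_itv/= -ler_norml ltW// archi_boundP.
have cvgK : (\int[mu]_(s in S m) (K s)%:E @[m --> \oo] --> \int[mu]_s (K s)%:E)%E.
  rewrite -US; apply: ge0_nondecreasing_set_cvg_integral.
  - move=> i j ij; apply/subsetPset => s; rewrite /S /= !in_itv/= -!ler_norml => si.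
    by rewrite (le_trans si)// ler_nat.
  - by move=> m; exact: measurable_itv.
  - move=> m; apply: measurable_funTS.
    by apply/measurable_EFinP; exact: continuous_measurable_fun.
  - by move=> m s _; rewrite lee_fin powR_ge0.
have K0 : A * K (- m%:R) @[m --> \oo] --> (0 : R).
  rewrite -[X in _ --> X](mulr0 A); apply: cvgM; first exact: cvg_cst.
  have g0' : g (- m%:R) @[m --> \oo] --> (0 : R).
    apply: (cvg_comp (fun m : nat => - m%:R : R) g _ g0).
    by apply: (cvg_comp (fun m : nat => m%:R : R) -%R cvgr_idn); rewrite ninfty.
  have := cvg_comp _ _ g0' (continuous_norm_powR p0 (x := 0)).
  by rewrite normr0 powR0// gt_eqF.
(* The constant [A] may have either sign, so the left boundary term [A * K (- m)] is not dropped but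
   made smaller than [e]; the right one is zero once [m >= M]. Monotone convergence over the
   segments then concludes, finite integral or not. *)
apply/lee_addgt0Pr => e e0.
suff H : \forall m \near \oo, ((`|a| `^ p)%:E * \int[mu]_(s in S m) (K s)%:E <=
    \int[mu]_s (F s)%:E + e%:E)%E.
  by apply: (cvge_le H); exact: cvgeZl cvgK.
near=> m.
have m0 : (0 : R) < m%:R by near: m; exact: nbhs_infty_gtr.
have Mm : M <= m%:R by near: m; exact: nbhs_infty_ger.
have := @segment_bound (- m%:R) m%:R; rewrite gtrN// => /(_ isT).
rewrite {2}/K gM// normr0 powR0 ?gt_eqF// sub0r mulrN EFinN => H.
have {}H := leeD2r (A * K (- m%:R))%:E H.
rewrite -addeA (addeC (- _)%E) subee// adde0 in H.
apply: (le_trans H); rewrite leeD2l// lee_fin.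
by near: m; apply: cvgr_le K0 _ e0.
Unshelve. all: by end_near. Qed.

End one_dimensional_hardy.


(** * Measurability and polar integration *)

Section continuous_measurable.
Context {R : realType} {n : nat}.
Local Notation G := (@grushin R n).
Local Notation mG := ('rV[R]_n * measurableTypeR R)%type.

(** The sigma-algebra on row vectors is generated by the coordinates rather than by open sets, so
    continuous functions are reached as limits of functions that factor through a countable set of
    grid points. *)
Lemma measurable_fun_countable d (T : measurableType d) (C : countType) (k : T -> C)
    d' (U : measurableType d') (h : C -> U) :
  (forall c, measurable (k @^-1` [set c])) -> measurable_fun setT (h \o k).
Proof.
move=> mk _ B mB; rewrite setTI.
rewrite (_ : _ @^-1` B = \bigcup_(c : C) (k @^-1` [set c] `&` [set _ | B (h c)])).
  apply: countable_bigcupT_measurable => // c.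
  have [Bh|Bh] := pselect (B (h c)).
    rewrite (_ : [set _ | _] = setT) ?setIT//.
    by apply/seteqP; split.
  rewrite (_ : [set _ | _] = set0) ?setI0//.
  by apply/seteqP; split.
apply/seteqP; split => [t Bt|t [c _ [/= <-]]]; last by [].
by exists (k t).
Qed.

(** The integer label of the cell of [r] for mesh [1 / (m + 1)]. *)
Definition grid (m : nat) (r : R) : int := Num.floor (m.+1%:R * r).

Lemma grid_cvg (r : R) : (grid m r)%:~R / m.+1%:R @[m --> \oo] --> r.
Proof.
apply/cvgrPdist_le => e e0; near=> m.
have m0 : (0 : R) < m.+1%:R by rewrite ltr0n.
have := floor_itv (m.+1%:R * r); rewrite intrD -/(grid m r) => /andP[f1 f2].
have -> : r - (grid m r)%:~R / m.+1%:R = (m.+1%:R * r - (grid m r)%:~R) / m.+1%:R.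
  by field; rewrite gt_eqF.
rewrite ger0_norm ?divr_ge0 ?subr_ge0 ?(ltW m0)// ler_pdivrMr//.
have em : 1 <= e * m.+1%:R.
  rewrite -ler_pdivrMl// mulr1 (@le_trans _ _ m%:R)// ?ler_nat//.
  by near: m; exact: nbhs_infty_ger.
by apply: le_trans em; rewrite lerBlDl; exact: ltW.
Unshelve. all: by end_near. Qed.

Lemma measurable_grid d (T : measurableType d) (f : T -> measurableTypeR R) m c :
  measurable_fun setT f -> measurable [set t | grid m (f t) = c].
Proof.
move=> mf; rewrite (_ : [set _ | _] =
    (fun t => m.+1%:R * f t) @^-1` `[(c%:~R : R), (c + 1)%:~R[%classic).
  rewrite -[X in measurable X]setTI; apply: (@measurable_funM _ _ _ _ (cst _) f) => //.
apply/seteqP; split=> t /=; rewrite in_itv/=.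
  by move=> <-; exact: floor_itv.
by rewrite -floor_eq => /eqP.
Qed.

(* A continuous function is the limit of its values at the points rounded to a grid. *)
Lemma continuous_measurable_grushin (u : G -> R) :
  continuous u -> measurable_fun setT (u : mG -> measurableTypeR R).
Proof.
move=> cu.
pose k m (z : mG) : {ffun 'I_n -> int} * int := ([ffun i => grid m (z.1 ord0 i)], grid m z.2).
pose h (m : nat) (c : {ffun 'I_n -> int} * int) : G :=
  \sum_(i < n) ((c.1 i)%:~R / m.+1%:R) *: xdir i + (c.2%:~R / m.+1%:R) *: tdir.
apply: (@measurable_fun_cvg _ _ _ _ (fun m => (u \o h m) \o k m)).
- move=> m; apply: measurable_fun_countable => -[c1 c2].
  rewrite (_ : _ @^-1` _ = (\bigcap_(i in [set: 'I_n])
      [set z : mG | grid m (z.1 ord0 i) = c1 i]) `&` [set z | grid m z.2 = c2]).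
    apply: measurableI; last by apply: measurable_grid.
    apply: fin_bigcap_measurable => // i _; apply: measurable_grid.
    by apply: (measurableT_comp (measurable_coord_rV i)).
  apply/seteqP; split=> [z [<- <-]|z [/= z1 <-]].
    by split=> // i _; rewrite /= ffunE.
  by congr pair; apply/ffunP => i; rewrite ffunE z1.
- move=> z _.
  have hz : h m (k m z) @[m --> \oo] --> (z : G).
    rewrite [X in _ --> X]grushin_decomp; apply: cvgD.
      apply: cvg_seq_sum => i; apply: cvgZr_tmp.
      rewrite (_ : (fun m => _) = fun m => (grid m (z.1 ord0 i))%:~R / m.+1%:R).
        exact: grid_cvg.
      by apply/funext => m; rewrite ffunE.
    by apply: cvgZr_tmp; exact: grid_cvg.
  exact: (cvg_comp _ _ hz (cu z)).
Qed.

End continuous_measurable.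


(** * Change of variables for maps that scale a measure *)

Section scaling_maps.
Context {R : realType}.
Local Open Scope ereal_scope.

Definition scales d (T : measurableType d) (mu : set T -> \bar R) (phi : T -> T) (k : R) :=
  measurable_fun setT phi /\
  forall A, measurable A -> mu (phi @^-1` A) = k%:E * mu A.

Lemma ge0_integral_scales d (T : measurableType d) (mu : {measure set T -> \bar R})
    (phi : T -> T) (k : R) (f : T -> \bar R) :
  scales mu phi k -> (0 <= k)%R -> measurable_fun setT f -> (forall x, 0 <= f x) ->
  \int[mu]_x f (phi x) = k%:E * \int[mu]_x f x.
Proof.
move=> [mphi muk] k0 mf f0.
have := @ge0_integral_pushforward _ _ _ _ _ _ mphi mu setT f measurableT mf (fun x _ => f0 x).
rewrite preimage_setT => <-.
rewrite -(ge0_integral_mscale mu measurableT (NngNum k0) mf (fun x _ => f0 x)).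
by apply: eq_measure_integral => A mA _; exact: muk.
Qed.

(** The pushforward multiplied by [c] agrees with Lebesgue measure on half-open intervals, so
    uniqueness identifies them. *)
Lemma scales_lebesgue (c : R) : (0 < c)%R ->
  scales (@lebesgue_measure R) ( *%R c : measurableTypeR R -> measurableTypeR R) c^-1.
Proof.
move=> c0; have mphi : measurable_fun setT
    ( *%R c : measurableTypeR R -> measurableTypeR R) by exact: mulrl_measurable.
split=> // A mA.
pose m := mscale (NngNum (ltW c0)) (measure_function_pushforward__canonical__measure_function_Measure
    (@lebesgue_measure R) mphi).
have H := @lebesgue_measure_unique R m.
rewrite (H _ A mA) /m /mscale/= ?muleA -?EFinM ?mulVf ?mul1e ?gt_eqF//.
move=> _ [[a b]] _ <- /=.
rewrite /mscale/= /pushforward.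
rewrite (_ : _ @^-1` _ = `](a / c)%R, (b / c)%R]%classic).
  rewrite !lebesgue_measure_itv/= !lte_fin ltr_pM2r ?invr_gt0//.
  case: ifPn; last by rewrite mule0.
  by rewrite -!EFinD -EFinM -mulrBl mulrC divfK ?gt_eqF.
by apply/seteqP; split=> x /=; rewrite !in_itv/= ltr_pdivrMr// ler_pdivlMr// ![(x * c)%R]mulrC.
Qed.

Lemma mule_unscale (a b : R) (x y : \bar R) : a != 0%R -> b != 0%R ->
  ((a * b)^-1)%:E * ((a%:E * x) * (b%:E * y)) = x * y.
Proof.
move=> a0 b0; rewrite muleACA -EFinM !muleA -EFinM mulVf ?mul1e//.
by rewrite mulf_neq0.
Qed.

(** Uniqueness of the product measure, applied to the pushforward divided by [k1 * k2], which has
    the right value on rectangles. *)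
Lemma scales_product d1 d2 (T1 : measurableType d1) (T2 : measurableType d2)
    (m1 : {sigma_finite_measure set T1 -> \bar R})
    (m2 : {sigma_finite_measure set T2 -> \bar R})
    (phi1 : T1 -> T1) (phi2 : T2 -> T2) (k1 k2 : R) :
  (0 < k1)%R -> (0 < k2)%R -> scales m1 phi1 k1 -> scales m2 phi2 k2 ->
  scales (m1 \x m2) (fun z => (phi1 z.1, phi2 z.2)) (k1 * k2).
Proof.
move=> k10 k20 [mp1 s1] [mp2 s2].
have mp : measurable_fun setT (fun z : T1 * T2 => (phi1 z.1, phi2 z.2)).
  by apply: measurable_fun_pair; exact: measurableT_comp.
split=> // A mA.
have k0 : (0 <= (k1 * k2)^-1)%R by rewrite invr_ge0 ltW// mulr_gt0.
pose m := mscale (NngNum k0) (measure_function_pushforward__canonical__measure_function_Measure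
    (m1 \x m2) mp).
have H := @product_measure_unique _ _ _ _ R m1 m2 m.
rewrite (H _ A mA) /m /mscale/= ?muleA -?EFinM ?divff ?mul1e ?gt_eqF ?mulr_gt0//.
move=> B C mB mC; rewrite /mscale/= /pushforward.
rewrite (_ : _ @^-1` _ = (phi1 @^-1` B) `*` (phi2 @^-1` C)) //.
have mB' : measurable (phi1 @^-1` B) by rewrite -[X in measurable X]setTI; exact: mp1.
have mC' : measurable (phi2 @^-1` C) by rewrite -[X in measurable X]setTI; exact: mp2.
rewrite product_measure1E//.
transitivity (((k1 * k2)^-1)%:E * ((k1%:E * m1 B) * (k2%:E * m2 C))).
  by congr (_ * (_ * _)); [exact: s1|exact: s2].
by rewrite mule_unscale ?gt_eqF.
Qed.

(** Induction along the recursive construction of [lebesgue_rV]: [cons_rV] commutes with the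
    scaling. *)
Lemma scales_rV n (c : R) : (0 < c)%R ->
  scales (@lebesgue_rV R n) ( *:%R c) (c^-1 ^+ n).
Proof.
move=> c0; elim: n => [|n [mn IH]].
  split=> [|A mA].
    by apply: measurable_fun_rV => -[].
  rewrite expr0 mul1e (_ : _ @^-1` _ = A)//.
  by apply/seteqP; split=> x /=; rewrite (_ : c *: x = x)//; apply/rowP => -[].
have c'0 : (0 < c^-1)%R by rewrite invr_gt0.
have [mp H] := scales_product c'0 (exprn_gt0 n c'0) (scales_lebesgue c0) (conj mn IH).
split=> [|A mA].
  apply: measurable_fun_rV => i.
  rewrite (_ : (fun _ => _) = fun v : 'rV[R]_n.+1 => c * (v ord0 i : measurableTypeR R))%R.
    by apply: measurable_funM => //; exact: measurable_coord_rV.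
  by apply/funext => v; rewrite mxE.
rewrite /= /lebesgue_rV_step /pushforward exprS -H; last first.
  by rewrite -[X in measurable X]setTI; exact: measurable_cons_rV.
congr (_ _); apply/seteqP.
have E (z : measurableTypeR R * 'rV[R]_n) : cons_rV (c * z.1, c *: z.2)%R = c *: cons_rV z.
  apply/rowP => i; rewrite [RHS]mxE /cons_rV; case: (@split_ordP 1 n i) => j ->.
  - by rewrite !(@row_mxEl _ 1 1 n) !mxE !ord1 !mulr1n.
  - by rewrite !(@row_mxEr _ 1 1 n) mxE.
by split=> z /=; rewrite E.
Qed.

End scaling_maps.

Section polar.
Context {R : realType} {n : nat}.
Local Notation G := (@grushin R n).
Local Notation mG := ('rV[R]_n * measurableTypeR R)%type.
Local Notation Q := (@hdim R n).
Local Notation muG := (@lebesgue_rV R n \x @lebesgue_measure R)%E.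

(** The origin of [Q = n + 2]: each of the [n] coordinates of [x] contributes [e^-s], and [t]
    contributes [e^(-2s)]. *)
Lemma scales_dilation (s : R) :
  scales muG (dilation s : mG -> mG) (expR (- (Q * s))).
Proof.
have := scales_product _ _ (@scales_rV R n _ (expR_gt0 s)) (scales_lebesgue (expR_gt0 (2 * s))).
rewrite exprn_gt0 ?invr_gt0 ?expR_gt0// => /(_ isT isT).
rewrite -!expRN -expRM_natl -expRD (_ : n%:R * - s + - (2 * s) = - (Q * s))//.
by rewrite /hdim; ring.
Qed.

Lemma measurable_dilation :
  measurable_fun setT (fun w : mG * measurableTypeR R => (dilation w.2 w.1 : mG)).
Proof.
apply: measurable_fun_pair; last first.
  apply: measurable_funM; last by do 2 apply: measurableT_comp => //.
  by apply: measurableT_comp => //; apply: measurable_funM.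
apply: measurable_fun_rV => i.
rewrite (_ : (fun _ => _) = fun w : mG * measurableTypeR R => expR w.2 * w.1.1 ord0 i).
  apply: measurable_funM; first by apply: measurableT_comp.
  apply: (measurableT_comp (measurable_coord_rV i)).
  by apply: measurableT_comp.
by apply/funext => w; rewrite mxE.
Qed.

End polar.


Section sigma_finite_product.
Context d1 d2 (T1 : measurableType d1) (T2 : measurableType d2) (R : realType).
Variables (m1 : {sigma_finite_measure set T1 -> \bar R})
  (m2 : {sigma_finite_measure set T2 -> \bar R}).

Lemma product_sigma_finite : sigma_finite setT (m1 \x m2)%E.
Proof.
have /sigma_finiteP[A [UA ndA mA]] := sigma_finiteT m1.
have /sigma_finiteP[B [UB ndB mB]] := sigma_finiteT m2.
exists (fun k => A k `*` B k).
  apply/esym; rewrite -subTset => -[x y] _.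
  have [i _ Ax] : (\bigcup_k A k) x by rewrite -UA.
  have [j _ By] : (\bigcup_k B k) y by rewrite -UB.
  exists (i + j)%N => //; split => /=.
    by move: x Ax; apply/subsetPset/ndA/leq_addr.
  by move: y By; apply/subsetPset/ndB/leq_addl.
move=> k; have [mAk Ak] := mA k; have [mBk Bk] := mB k.
split; first exact: measurableX.
by rewrite product_measure1E// lte_mul_pinfty// ge0_fin_numE.
Qed.

Definition sigma_finite_product : {sigma_finite_measure set (T1 * T2)%type -> \bar R} :=
  HB.pack (m1 \x m2)%E (Measure_isSigmaFinite.Build _ _ _ (m1 \x m2)%E product_sigma_finite).

End sigma_finite_product.

Section polar_integration.
Context {R : realType} {n : nat}.
Local Notation G := (@grushin R n).
Local Notation mG := ('rV[R]_n * measurableTypeR R)%type.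
Local Notation Q := (@hdim R n).
Local Notation mu := (@lebesgue_measure R).

(** The annulus [1 <= rho < e], since [gauge = rho^4]. *)
Definition shell : set mG := [set z | 1 <= gauge (z : G) < expR 4].

Lemma measurable_sqn : measurable_fun setT (fun z : mG => sqn (z : G)).
Proof. by apply: continuous_measurable_grushin; exact/smooth_continuous/smooth_sqn. Qed.

Lemma measurable_gauge : measurable_fun setT (fun z : mG => gauge (z : G)).
Proof. by apply: continuous_measurable_grushin; exact/smooth_continuous/smooth_gauge. Qed.

Lemma measurable_shell : measurable shell.
Proof.
rewrite (_ : shell = (fun z : mG => gauge (z : G)) @^-1` `[1, expR 4[%classic).
  by rewrite -[X in measurable X]setTI; exact: measurable_gauge.
by apply/seteqP; split => z /=; rewrite in_itv.
Qed.

Lemma dilationK (s : R) (z : G) : dilation (- s) (dilation s z) = z.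
Proof.
case: z => x t; rewrite /dilation /= scalerA mulrA -!expRD.
by rewrite mulrN !addNr expR0 scale1r mul1r.
Qed.

(** Dilating by [-s] lowers [ln rho] by [s], so the times form the half-open unit interval ending at
    [L = ln rho]. *)
Lemma lebesgue_shell_time (z : G) : 0 < gauge z ->
  mu [set s | shell (dilation (- s) z)] = 1%E.
Proof.
move=> gz; pose L := ln (gauge z) / 4.
rewrite (_ : [set _ | _] = `]L - 1, L]%classic).
  by rewrite lebesgue_measure_itv/= lte_fin gtrBl ltr01 -EFinB opprB addrC subrK.
have gE : gauge z = expR (4 * L) by rewrite /L mulrC divfK// lnK.
have e1 x : (1 <= expR x) = (0 <= x) :> bool by rewrite -[X in X <= _]expR0 ler_expR.
apply/seteqP; split=> s; rewrite /shell /= in_itv/= gauge_dilation gE -expRD.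
  by rewrite e1 ltr_expR => /andP[? ?]; apply/andP; split; lra.
by rewrite e1 ltr_expR => /andP[? ?]; apply/andP; split; lra.
Qed.

(** The same set function as [grushin_measure], bundled as sigma-finite so that Tonelli applies to
    it and the orbit time. *)
Definition grushin_sigma_finite : {sigma_finite_measure set mG -> \bar R} :=
  sigma_finite_product (@lebesgue_rV R n) (@lebesgue_measure R).

Lemma integral_grushin_measure (F : mG -> \bar R) :
  (\int[grushin_measure]_z F z = \int[grushin_sigma_finite]_z F z)%E.
Proof. exact: eq_measure_integral. Qed.

Section polar.
Variable nu : {sigma_finite_measure set mG -> \bar R}.
Hypothesis nuP : forall s, scales nu (dilation s : mG -> mG) (expR (- (Q * s))).

(* Every dilation orbit other than the origin spends unit time in the shell, so averaging
   [F] over dilations and exchanging the integrals gives polar coordinates. *)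
Lemma integral_polar_homog (F : mG -> \bar R) : measurable_fun setT F ->
  (forall z, 0 <= F z)%E -> F (0, 0) = 0%E ->
  (\int[nu]_z F z =
   \int[nu]_(z in shell) \int[mu]_s (F (dilation s z) * (expR (Q * s))%:E))%E.
Proof.
move=> mF F0 Fz.
pose f (w : mG * measurableTypeR R) : \bar R :=
  ((\1_shell w.1)%:E * (F (dilation w.2 w.1) * (expR (Q * w.2))%:E))%E.
have m1 : measurable_fun setT (fun z : mG => (\1_shell z)%:E : \bar R).
  have H : measurable_fun setT (\1_shell : mG -> R).
    by apply: measurable_indic; exact: measurable_shell.
  exact: (measurable_EFinP _ _).2 H.
have mFd : measurable_fun setT (fun w : mG * measurableTypeR R => F (dilation w.2 w.1)).
  exact: (measurableT_comp mF measurable_dilation).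
have md' : measurable_fun setT
    (fun w : mG * measurableTypeR R => (dilation (- w.2) w.1 : mG)).
  pose h (w : mG * measurableTypeR R) : mG * measurableTypeR R := (w.1, - w.2).
  have mh : measurable_fun setT h.
    apply: measurable_fun_pair; first exact: measurable_fst.
    exact: (measurableT_comp (@oppr_measurable R setT) measurable_snd).
  exact: (measurableT_comp measurable_dilation mh).
have me : measurable_fun setT (fun w : mG * measurableTypeR R => (expR (Q * w.2))%:E : \bar R).
  by apply/measurable_EFinP; apply: measurableT_comp => //; apply: measurable_funM.
have mf : measurable_fun setT f.
  apply: emeasurable_funM; first exact: (measurableT_comp m1 measurable_fst).
  exact: emeasurable_funM mFd me.
have f0 w : (0 <= f w)%E.
  by rewrite !mule_ge0// lee_fin ?expR_ge0.
have fub : (\int[nu]_z \int[mu]_s f (z, s) = \int[mu]_s \int[nu]_z f (z, s))%E.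
  exact: fubini_tonelli.
transitivity (\int[nu]_z \int[mu]_s f (z, s))%E; last first.
  rewrite [RHS]integral_mkcond; apply: eq_integral => z _.
  rewrite patchE /f /=; case: ifPn => zs.
    by apply: eq_integral => s _; rewrite indicE zs mul1e.
  rewrite integral0_eq// => s _.
  by rewrite indicE (negPf zs) mul0e.
rewrite fub.
(* The double integral after replacing [z] by its dilation: the shell condition moves to
   [dilation (- s) z], and the Jacobian cancels [expR (Q * s)]. *)
transitivity (\int[mu]_s \int[nu]_z ((\1_shell (dilation (- s) z))%:E * F z))%E.
  pose f' (w : mG * measurableTypeR R) : \bar R :=
    ((\1_shell (dilation (- w.2) w.1))%:E * F w.1)%E.
  have mf' : measurable_fun setT f'.
    apply: emeasurable_funM; first exact: (measurableT_comp m1 md').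
    exact: (measurableT_comp mF measurable_fst).
  have f'0 w : (0 <= f' w)%E by rewrite mule_ge0.
  have <- : (\int[nu]_z \int[mu]_s f' (z, s) = \int[mu]_s \int[nu]_z f' (z, s))%E.
    exact: fubini_tonelli.
  apply: eq_integral => z _; rewrite /f' /=.
  rewrite ge0_integralZr//; last first.
    exact: (measurableT_comp m1 (measurable_fun_pair2 z md')).
  have [gz|] := ltP 0 (gauge z).
    rewrite (_ : (fun _ => _) = EFin \o (\1_[set s | shell (dilation (- s) z)] : R -> R)).
      rewrite integral_indic// ?setIT.
        by rewrite -[LHS]mul1e; congr (_ * _)%E; exact/esym/lebesgue_shell_time.
      rewrite -[X in measurable X]setTI.
      by apply: (measurable_fun_pair2 z md') => //; exact: measurable_shell.
    by apply/funext => s.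
  (* The orbit of the origin never meets the shell; there both sides vanish by [F (0, 0) = 0]. *)
  rewrite le_eqVlt ltNge gauge_ge0 orbF => /eqP/gauge_eq0 ->.
  by rewrite Fz mule0.
apply: eq_integral => s _; rewrite /f /=.
have Fs0 z : (0 <= (\1_shell (dilation (- s) z))%:E * F z)%E by rewrite mule_ge0.
have mFs : measurable_fun setT (fun z : mG => (\1_shell (dilation (- s) z))%:E * F z)%E.
  apply: emeasurable_funM mF.
  exact: (measurableT_comp m1 (measurable_fun_pair1 (s : measurableTypeR R) md')).
(* A factor 1 is inserted so that the change of variables can be read from right to left. *)
have -> : (\int[nu]_z ((\1_shell (dilation (- s) z))%:E * F z) =
   (expR (Q * s))%:E * ((expR (- (Q * s)))%:E *
   \int[nu]_z ((\1_shell (dilation (- s) z))%:E * F z)))%E.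
  by rewrite muleA -EFinM -expRD subrr expR0 mul1e.
rewrite -(ge0_integral_scales (nuP s)) ?expR_ge0//.
rewrite -ge0_integralZl_EFin ?expR_ge0//.
- apply: eq_integral => z _; rewrite dilationK muleCA; congr (_ * _)%E.
  by rewrite muleC.
- exact: measurableT_comp mFs (measurable_fun_pair1 (s : measurableTypeR R) measurable_dilation).
Qed.

End polar.

Lemma integral_polar (F : mG -> \bar R) : measurable_fun setT F ->
  (forall z, 0 <= F z)%E -> F (0, 0) = 0%E ->
  (\int[grushin_sigma_finite]_z F z =
   \int[grushin_sigma_finite]_(z in shell)
     \int[mu]_s (F (dilation s z) * (expR (Q * s))%:E))%E.
Proof. by apply: integral_polar_homog => s; exact: scales_dilation. Qed.

End polar_integration.


(** * The energy inequality *)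

Section test_function_bounds.
Context {R : realType} {V : normedModType R}.

(** Used with [w = u] to bound [u], and with [w = gauge] to bound the region where [u] is
    nonzero. *)
Lemma test_function_bounded_on (u w : V -> R) : test_function u -> continuous w ->
  exists M : R, forall z, u z != 0 -> `|w z| <= M.
Proof.
move=> [_ cu] cw.
have /compact_bounded/pinfty_ex_gt0[M _ MP] : compact (w @` closure [set z | u z != 0]).
  by apply: continuous_compact cu; exact: continuous_subspaceT.
exists M => z uz; apply: MP; exists z => //.
exact: subset_closure.
Qed.

End test_function_bounds.

Section energy.
Context {R : realType} {n : nat}.
Local Notation G := (@grushin R n).
Local Notation mG := ('rV[R]_n * measurableTypeR R)%type.
Local Notation Q := (@hdim R n).
Local Notation mu := (@lebesgue_measure R).
Local Notation nu := (@grushin_sigma_finite R n).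
Variables (p gam : R).
Hypothesis p1 : 1 < p.

Let p0 : 0 < p. Proof. exact: lt_trans p1. Qed.

(* [psi 0 = 0], as division by zero gives zero, hence [weight 0 = 0]. *)
Definition weight (z : G) : R := psi z `^ (p / 2) * rho z `^ (- gam).
(** The exponent [a] for which [weight * rho^(a p)] has degree [-Q]; it is [s0] of the overview when
    [gam = k p + beta]. *)
Definition crit_exp : R := (gam - Q) / p.
Definition energy (v : G -> R) : \bar R := (\int[nu]_z (weight z * `|v z| `^ p)%:E)%E.

Lemma weight_ge0 z : 0 <= weight z.
Proof. by rewrite mulr_ge0// powR_ge0. Qed.

Lemma psi_dilation s (z : G) : psi (dilation s z) = psi z.
Proof.
rewrite !psiE sqn_dilation gauge_dilation powRM ?expR_ge0 ?gauge_ge0//.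
rewrite -expRM (_ : 4 * s * 2^-1 = 2 * s); last by field.
by rewrite invfM mulrACA divff ?mul1r// gt_eqF ?expR_gt0.
Qed.

Lemma rho_dilation s (z : G) : rho (dilation s z) = expR s * rho z.
Proof.
rewrite !rhoE gauge_dilation powRM ?expR_ge0 ?gauge_ge0//.
by rewrite -expRM (_ : 4 * s * 4^-1 = s)//; field.
Qed.

Lemma weight_dilation s z : weight (dilation s z) = expR (- gam * s) * weight z.
Proof.
rewrite /weight psi_dilation rho_dilation powRM ?expR_ge0//; last by rewrite rhoE powR_ge0.
by rewrite -expRM (mulrC s) mulrCA.
Qed.

Lemma psi0 : psi (0 : G) = 0.
Proof.
by rewrite psiE /sqn big1 ?mul0r// => i _; rewrite mxE expr0n.
Qed.

Lemma weight0 : weight 0 = 0.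
Proof. by rewrite /weight psi0 powR0 ?mul0r// gt_eqF// divr_gt0. Qed.

Lemma measurable_weight : measurable_fun setT (weight : mG -> R).
Proof.
have mpsi : measurable_fun setT (fun z : mG => psi (z : G)).
  rewrite (_ : (fun _ => _) = fun z : mG => sqn (z : G) * gauge (z : G) `^ (- 2^-1)).
    apply: measurable_funM; first exact: measurable_sqn.
    exact: (measurableT_comp (measurable_powR _) measurable_gauge).
  by apply/funext => z; rewrite psiE powRN.
have mrho : measurable_fun setT (fun z : mG => rho (z : G)).
  rewrite (_ : (fun _ => _) = fun z : mG => gauge (z : G) `^ (4^-1)).
    exact: (measurableT_comp (measurable_powR _) measurable_gauge).
  by apply/funext => z; rewrite rhoE.
apply: measurable_funM.
  exact: (measurableT_comp (measurable_powR _) mpsi).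
exact: (measurableT_comp (measurable_powR _) mrho).
Qed.

Lemma measurable_energy_density (v : G -> R) : continuous v ->
  measurable_fun setT (fun z : mG => (weight z * `|v z| `^ p)%:E).
Proof.
move=> cv; apply/measurable_EFinP/measurable_funM; first exact: measurable_weight.
apply: (measurableT_comp (measurable_powR _)).
apply: (measurableT_comp (@normr_measurable R setT)).
exact: continuous_measurable_grushin.
Qed.

Definition ray (v : G -> R) (z : G) (s : R) : R :=
  expR (- crit_exp * s) * v (dilation s z).

Lemma measurable_ray (v : G -> R) : continuous v ->
  measurable_fun setT (fun w : mG * measurableTypeR R => (`|ray v w.1 w.2| `^ p)%:E).
Proof.
move=> cv; apply/measurable_EFinP; apply: (measurableT_comp (measurable_powR _)).
apply: (measurableT_comp (@normr_measurable R setT)); apply: measurable_funM.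
  exact: (measurableT_comp (@measurable_expR R)
    (measurableT_comp (mulrl_measurable _) measurable_snd)).
exact: (measurableT_comp (continuous_measurable_grushin cv) measurable_dilation).
Qed.

Lemma measurable_ray_energy (v : G -> R) : continuous v ->
  measurable_fun shell (fun z : mG => (weight z)%:E * \int[mu]_s (`|ray v z s| `^ p)%:E)%E.
Proof.
move=> cv; apply: measurable_funTS; apply: emeasurable_funM.
  by apply/measurable_EFinP; exact: measurable_weight.
apply: (measurable_fun_fubini_tonelli_F _ (measurable_ray cv)).
by move=> w; rewrite lee_fin powR_ge0.
Qed.

Lemma ray_energy_ge0 (v : G -> R) (z : G) : (0 <= \int[mu]_s (`|ray v z s| `^ p)%:E)%E.
Proof. by apply: integral_ge0 => s _; rewrite lee_fin powR_ge0. Qed.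

(** Along an orbit the weight contributes [e^(- gam s)] and the volume [e^(Q s)]; their product is
    [e^(- p s0 s)], which [ray] absorbs, so the orbit integral carries no weight in [s]. *)
Lemma energy_polar (v : G -> R) : continuous v ->
  energy v = (\int[nu]_(z in shell) ((weight z)%:E * \int[mu]_s (`|ray v z s| `^ p)%:E))%E.
Proof.
move=> cv; rewrite /energy integral_polar; last 3 first.
- exact: measurable_energy_density.
- by move=> z; rewrite lee_fin mulr_ge0 ?weight_ge0 ?powR_ge0.
- by rewrite weight0 mul0r.
apply: eq_integral => z _.
rewrite -ge0_integralZl_EFin ?weight_ge0//; last first.
  exact: (measurable_fun_pair2 (z : mG) (measurable_ray cv)).
apply: eq_integral => s _; rewrite -!EFinM; congr EFin.
rewrite weight_dilation /ray normrM (ger0_norm (expR_ge0 _)) powRM ?expR_ge0//.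
rewrite -expRM (_ : - crit_exp * s * p = - gam * s + Q * s); first by rewrite expRD; ring.
by rewrite /crit_exp; field; rewrite gt_eqF.
Qed.

Lemma is_derive_ray (v : G -> R) z (s : R) : smooth v ->
  is_derive s (1 : R) (ray v z) (ray (euler v) z s - crit_exp * ray v z s).
Proof.
move=> sv; have dv := is_derive_dilation z s sv.
apply: is_derive_eq.
rewrite [X in _ *: (_ * X)]mulr1 /ray /GRing.scale/=; ring.
Qed.

Lemma energy_shifted_euler (c : R) (v : G -> R) : gam < Q -> test_function v ->
  ((`|crit_exp + c| `^ p)%:E * energy v <= energy (shifted_euler c v))%E.
Proof.
move=> gQ tv; have [sv cv] := tv.
have s0 : crit_exp < 0 by rewrite /crit_exp pmulr_llt0 ?invr_gt0// subr_lt0.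
have csv := smooth_continuous (smooth_shifted_euler c sv).
rewrite (energy_polar (smooth_continuous sv)) (energy_polar csv).
have E0 w (z : mG) : (0 <= (weight z)%:E * \int[mu]_s (`|ray w z s| `^ p)%:E)%E.
  by rewrite mule_ge0 ?lee_fin ?weight_ge0 ?ray_energy_ge0.
have mE := measurable_ray_energy (smooth_continuous sv).
rewrite -(ge0_integralZl_EFin nu measurable_shell (fun z _ => E0 v z) mE) ?powR_ge0//.
apply: ge0_le_integral; first exact: measurable_shell.
- by move=> z _; rewrite mule_ge0// lee_fin powR_ge0.
- exact: measurable_funeM.
- exact: (measurable_ray_energy csv).
move=> z zs.
have gz : 0 < gauge (z : G) by have /andP[z1 _] := zs; exact: lt_le_trans z1.
rewrite muleCA; apply: lee_wpmul2l; first by rewrite lee_fin weight_ge0.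
have [M MP] := test_function_bounded_on tv (smooth_continuous sv).
have [B BP] := test_function_bounded_on tv (smooth_continuous (@smooth_gauge R n)).
have -> : ray (shifted_euler c v) z = fun s =>
    (ray (euler v) z s - crit_exp * ray v z s) + (crit_exp + c) * ray v z s.
  by apply/funext => s; rewrite /ray /shifted_euler; ring.
have cr w : smooth w -> continuous (ray w z).
  move=> sw s; apply/differentiable_continuous/derivable1_diffP.
  exact: (ex_derive (is_derive := is_derive_ray z s sw)).
(* Where [v] is nonzero [gauge <= B], and the orbit passes this level at time
   [ln (B / gauge z) / 4]; adding 1 makes the inequality strict. *)
apply: (@hardy_line _ _ _ (ray v z) _ p1 (fun s => is_derive_ray z s sv) _
  (ln (B / gauge z) / 4 + 1)).
- move=> s; apply: cvgB; first exact/cr/smooth_euler.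
  by apply: cvgM; [exact: cvg_cst|exact: cr].
(* Decay at [-oo]: [v] is bounded and [expR (- crit_exp * s)] tends to 0 because [crit_exp < 0]. *)
- apply: norm_cvg0.
  have e0 : expR (- crit_exp * s) * `|M| @[s --> -oo] --> (0 : R).
    rewrite -[X in _ --> X](mul0r `|M|); apply: cvgM; last exact: cvg_cst.
    have e1 : - (- crit_exp * s) @[s --> -oo] --> +oo.
      have H1 : - crit_exp * s @[s --> -oo] --> -oo.
        by apply: gt0_cvgMrNy; [rewrite oppr_gt0|exact: cvg_id].
      exact/cvgNry.
    have e2 := cvg_comp _ _ e1 (@cvgr_expR R).
    apply: cvg_trans e2; apply: near_eq_cvg; apply: nearW => s.
    by rewrite /= opprK.
  apply: (squeeze_cvgr _ (cvg_cst 0) e0).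
  apply: nearW => s; rewrite normr_ge0/= /ray normrM (ger0_norm (expR_ge0 _)).
  rewrite ler_wpM2l ?expR_ge0//.
  have [->|vz] := eqVneq (v (dilation s z)) 0; first by rewrite normr0.
  by rewrite (le_trans (MP _ vz))// ler_norm.
- move=> s sB; rewrite /ray; have [->|vz] := eqVneq (v (dilation s z)) 0; first by rewrite mulr0.
  have := BP _ vz; rewrite gauge_dilation ger0_norm ?mulr_ge0 ?expR_ge0 ?gauge_ge0//.
  rewrite -ler_pdivlMr// => Bs.
  have B0 : 0 < B / gauge z by exact: lt_le_trans (expR_gt0 _) Bs.
  move: Bs; rewrite -{1}(lnK (x := B / gauge z)) ?posrE// ler_expR => Bs.
  by exfalso; lra.
Qed.

End energy.


(** * Sharpness *)

Section smooth1_closure.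
Context {R : realType}.
Implicit Types (f g h : R -> R).

(** With its converse below, it transfers the closure properties of [smooth] to [smooth1]: iterated
    [derive1] is differentiation along the constant list of directions 1. *)
Lemma smooth1_of_smooth h : smooth (h : R^o -> R) -> smooth1 h.
Proof.
move=> sh; have E m : derive1n m h = iter_derive (nseq m (1 : R^o)) (h : R^o -> R).
  elim: m => // m IH; rewrite derive1nS IH.
  by apply/funext => x; rewrite derive1E.
by move=> m x; rewrite E; exact: (sh (nseq m 1)).2.
Qed.

Lemma smooth_of_smooth1 h : smooth1 h -> smooth (h : R^o -> R).
Proof.
move=> sh; rewrite -[h]/(h \o (idfun : R^o -> R)); apply: smooth_comp1 => //.
by apply: (@smooth_linear R R^o (idfun : {linear R^o -> R^o})) => x; exact: cvg_id.
Qed.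

Lemma smooth1D f g : smooth1 f -> smooth1 g -> smooth1 (f \+ g).
Proof. by move=> sf sg; apply: smooth1_of_smooth; apply: smoothD; exact: smooth_of_smooth1. Qed.

Lemma smooth1M f g : smooth1 f -> smooth1 g -> smooth1 (f \* g).
Proof. by move=> sf sg; apply: smooth1_of_smooth; apply: smoothM; exact: smooth_of_smooth1. Qed.

Lemma smooth1_comp f g : smooth1 f -> smooth1 g -> smooth1 (f \o g).
Proof.
move=> sf sg; apply: smooth1_of_smooth; apply: smooth_comp1 => //.
exact: smooth_of_smooth1.
Qed.

Lemma smooth1_cst (c : R) : smooth1 (cst c).
Proof. by apply: smooth1_of_smooth; exact: smooth_cst. Qed.

Lemma smooth1_id : smooth1 (@idfun R).
Proof.
apply: smooth1_of_smooth.
by apply: (@smooth_linear R R^o (idfun : {linear R^o -> R^o})) => x; exact: cvg_id.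
Qed.

Lemma smooth1_affine (a b : R) : smooth1 (fun x => a * x + b).
Proof.
apply: (@smooth1D (fun x => a * x) (cst b)); last exact: smooth1_cst.
by apply: (@smooth1M (cst a) idfun); [exact: smooth1_cst|exact: smooth1_id].
Qed.

(** [smooth1] is the largest class of derivable functions stable under derivation; [P] is the
    invariant to be found in each application. *)
Lemma smooth1_coinduction (P : (R -> R) -> Prop) :
  (forall f, P f -> (forall x, derivable f x 1) /\ P (derive1 f)) ->
  forall f, P f -> smooth1 f.
Proof.
move=> PP f Pf m; have [] // := PP (derive1n m f).
by elim: m => // m IH; rewrite derive1nS; have [] := PP _ IH.
Qed.

Lemma smooth1_expR : smooth1 (@expR R).
Proof.
apply: (smooth1_coinduction (P := fun f => f = expR)) => // _ ->.
split=> [x|]; first exact: derivable_expR.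
by apply/funext => x; rewrite derive1E derive_val.
Qed.

End smooth1_closure.

Section flat_function.
Context {R : realType}.

(** For [m = 0] the classical flat function [e^(-1/x)]; the factors [x^-m] make the linear span of
    the family stable under derivation. *)
Definition flat (m : nat) (x : R) : R := if 0 < x then x ^- m * expR (- x^-1) else 0.

Lemma flat_le0 m (x : R) : x <= 0 -> flat m x = 0.
Proof. by rewrite /flat ltNge => ->. Qed.

(** One term of the exponential series, [e^y >= y^(m+1) / (m+1)!] at [y = 1/x]. *)
Lemma flat_bound m (x : R) : `|flat m x| <= (m.+1)`!%:R * `|x|.
Proof.
rewrite /flat; case: ltP => x0; last by rewrite normr0 mulr_ge0.
have y0 : 0 < x^-1 by rewrite invr_gt0.
have fac0 : (0 : R) < m.+1`!%:R by rewrite ltr0n fact_gt0.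
rewrite ger0_norm; last by rewrite mulr_ge0 ?expR_ge0// invr_ge0 exprn_ge0// ltW.
rewrite (gtr0_norm x0) expRN ler_pdivrMr ?expR_gt0//.
have := expR_ge1Dxn m (ltW y0); move=> H.
have {}H : x^-1 ^+ m.+1 / m.+1`!%:R <= expR x^-1 by apply: le_trans H; rewrite lerDr.
rewrite -(@ler_pM2l _ (m.+1`!%:R * x)) ?mulr_gt0// in H; apply: le_trans H.
rewrite -exprVn exprS le_eqVlt; apply/orP; left; apply/eqP.
by field; rewrite !gt_eqF.
Qed.

Lemma continuous0_flat m : {for 0, continuous (flat m)}.
Proof.
rewrite /prop_for /continuous_at flat_le0//; apply: norm_cvg0.
have H : (m.+1)`!%:R * `|x| @[x --> (0 : R)] --> (0 : R).
  rewrite -[X in _ --> X](mulr0 (m.+1)`!%:R) -{2}(normr0 R); apply: cvgM; first exact: cvg_cst.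
  exact: norm_continuous.
apply: (squeeze_cvgr _ (cvg_cst 0) H).
by apply: nearW => x; rewrite normr_ge0 flat_bound.
Qed.

Lemma is_derive_flat m (x : R) :
  is_derive x (1 : R) (flat m) (- m%:R * flat m.+1 x + flat m.+2 x).
Proof.
have [x0|x0|->] := ltgtP x 0.
- rewrite !flat_le0 ?(ltW x0)// mulr0 addr0.
  have H : is_derive x (1 : R) (cst 0 : R -> R) 0 by exact: is_derive_cst.
  apply: near_eq_is_derive H.
  near=> y; rewrite flat_le0//.
  by apply: ltW; near: y; exact: lt_nbhsl.
- have H : is_derive x (1 : R) (fun y => y ^- m * expR (- y^-1))
      (- m%:R * flat m.+1 x + flat m.+2 x).
    have xn : x != 0 by rewrite gt_eqF.
    have dV : is_derive x (1 : R) (fun y : R => y^-1) (- x ^- 2).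
      have := @is_deriveV R id x 1 1 xn (is_derive_id x 1).
      by rewrite [_ *: _]mulr1.
    have dh w : is_derive w (1 : R) (fun w => w ^+ m * expR (- w))
        (m%:R * w ^+ m.-1 * expR (- w) - w ^+ m * expR (- w)).
      have dX : is_derive w (1 : R) (fun w : R => w ^+ m) (m%:R * w ^+ m.-1).
        by constructor; [exact: exprn_derivable|rewrite exp_derive [_ *: 1]mulr1].
      have dE : is_derive w (1 : R) (fun w => expR (- w)) (- expR (- w)).
        by apply: is_derive_eq; rewrite mulrN1.
      have dM := is_deriveM dX dE; apply: is_derive_eq.
      by rewrite /GRing.scale/=; ring.
    have := is_derive1_comp (dh x^-1) dV.
    rewrite (_ : _ * (- x ^- 2) = - m%:R * flat m.+1 x + flat m.+2 x).
      rewrite (_ : _ \o _ = fun y => y ^- m * expR (- y^-1))//.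
      by apply/funext => y; rewrite /= exprVn.
    rewrite /flat x0 -!exprVn; case: m {dh} => [|m]; first by rewrite !expr0; ring.
    by rewrite -[m.+1.-1]/m !exprS; ring.
  apply: near_eq_is_derive H; near=> y; rewrite /flat (_ : 0 < y)//.
  by near: y; exact: lt_nbhsr.
- rewrite !flat_le0// mulr0 addr0.
  (* At 0 the difference quotient of [flat m] is exactly [flat m.+1], which is continuous there with
     value 0. *)
  apply/is_derive1_caratheodory; exists (flat m.+1); split.
  + move=> z; rewrite (flat_le0 m (lexx 0)) !subr0 /flat; case: ltP => z0; last by rewrite mul0r.
    have zm : z ^+ m != 0 by rewrite expf_neq0// gt_eqF.
    by rewrite exprS; field; rewrite zm gt_eqF.
  + exact: continuous0_flat.
  + exact: flat_le0.
Unshelve. all: by end_near. Qed.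

Inductive flat_span : (R -> R) -> Prop :=
| flat_span_base m : flat_span (flat m)
| flat_span_add f g : flat_span f -> flat_span g -> flat_span (f \+ g)
| flat_span_scale (c : R) f : flat_span f -> flat_span (fun x => c * f x).

Lemma flat_span_derive f : flat_span f ->
  exists2 f', flat_span f' & forall x : R, is_derive x (1 : R) f (f' x).
Proof.
elim=> {f} [m|f g _ [f' sf' df] _ [g' sg' dg]|c f _ [f' sf' df]].
- exists ((fun x => - m%:R * flat m.+1 x) \+ flat m.+2); last exact: is_derive_flat.
  by apply: flat_span_add; [apply: flat_span_scale|]; exact: flat_span_base.
- by exists (f' \+ g'); [exact: flat_span_add|move=> x; exact: is_deriveD].
- exists (fun x => c * f' x); first exact: flat_span_scale.
  by move=> x; apply: is_deriveZ.
Qed.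

Lemma smooth1_flat m : smooth1 (flat m).
Proof.
apply: (smooth1_coinduction (P := flat_span)); last exact: flat_span_base.
move=> f /flat_span_derive[f' sf' df]; split=> [x|]; 
  first exact: (ex_derive (is_derive := df x)).
rewrite (_ : derive1 f = f')//; apply/funext => x.
by rewrite derive1E (derive_val (is_derive := df x)).
Qed.

(** Vanishing below 1 makes the profiles built from it vanish near the origin, where [ln rho] is
    singular. *)
Definition bump_fun (x : R) : R := flat 0 (x - 1) * flat 0 (2 - x).

Lemma smooth1_bump : smooth1 bump_fun.
Proof.
apply: (@smooth1M _ (fun x => flat 0 (x - 1)) (fun x => flat 0 (2 - x))).
  rewrite (_ : (fun x => _) = flat 0 \o (fun x => 1 * x + (- 1))).
    by apply: smooth1_comp; [exact: smooth1_flat|exact: smooth1_affine].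
  by apply/funext => x; rewrite /= mul1r.
rewrite (_ : (fun x => _) = flat 0 \o (fun x => (- 1) * x + 2)).
  by apply: smooth1_comp; [exact: smooth1_flat|exact: smooth1_affine].
by apply/funext => x; rewrite /= mulN1r addrC.
Qed.

Lemma bump_gt0 x : 1 < x < 2 -> 0 < bump_fun x.
Proof.
move=> /andP[x1 x2]; rewrite /bump_fun /flat !subr_gt0 x1 x2.
by rewrite !mulr_gt0 ?expR_gt0// invr_gt0.
Qed.

Lemma bump_out x : ~~ (1 < x < 2) -> bump_fun x = 0.
Proof.
by rewrite negb_and /bump_fun /flat !subr_gt0 => /orP[/negPf ->|/negPf ->]; rewrite ?mul0r ?mulr0.
Qed.

End flat_function.


Section log_lift.
Context {R : realType}.
Implicit Types (F : R -> R).

Definition log_lift F (y : R) : R := if 0 < y then F (ln y) else 0.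

(** The derivative of [F (ln y)] is the lift of [expR (- x) * F' x], which again vanishes below [d]:
    the lifts of such smooth functions form a class stable under derivation. *)
Lemma smooth1_log_lift F (d : R) : 0 < d -> (forall x, x < d -> F x = 0) ->
  smooth1 F -> smooth1 (log_lift F).
Proof.
move=> d0 Fd sF; apply: (smooth1_coinduction (P := fun f => exists H,
  [/\ smooth1 H, forall x, x < d -> H x = 0 & f = log_lift H])); last by exists F.
move=> _ [H [sH Hd ->]].
have lift0 K y : (forall x, x < d -> K x = 0) -> y < expR d -> log_lift K y = 0.
  move=> Kd yd; rewrite /log_lift; case: ltP => // y0.
  by rewrite Kd// -ltr_expR lnK.
pose K x := expR (- x) * derive1 H x.
have Kd x : x < d -> K x = 0.
  move=> xd; rewrite /K derive1E (near_eq_derive (g := cst 0)) ?derive_cst ?mulr0//.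
  by near=> y; apply: Hd; near: y; exact: lt_nbhsl.
have dH (y : R) : is_derive y (1 : R) (log_lift H) (log_lift K y).
  have [yd|dy] := ltP y (expR d).
    rewrite lift0//; have Z : is_derive y (1 : R) (cst 0 : R -> R) 0 by exact: is_derive_cst.
    apply: near_eq_is_derive Z; near=> x; rewrite lift0//.
    by near: x; exact: lt_nbhsl.
  have y0 : 0 < y by apply: lt_le_trans dy; exact: expR_gt0.
  have Z : is_derive y (1 : R) (H \o @ln R) (log_lift K y).
    rewrite /log_lift y0 /K expRN lnK// mulrC.
    by apply: is_derive1_comp; [exact: smooth1_is_derive|exact: is_derive1_ln].
  apply: near_eq_is_derive Z; near=> x; rewrite /log_lift (_ : 0 < x)//.
  by near: x; exact: lt_nbhsr.
split=> [y|]; first exact: (ex_derive (is_derive := dH y)).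
exists K; split=> //.
  apply: (@smooth1M _ (fun x => expR (- x)) (derive1 H)); last exact: smooth1_derive1.
  rewrite (_ : (fun _ => _) = expR \o (fun x => (- 1) * x + 0)).
    by apply: smooth1_comp; [exact: smooth1_expR|exact: smooth1_affine].
  by apply/funext => x; rewrite /= addr0 mulN1r.
by apply/funext => y; rewrite derive1E (derive_val (is_derive := dH y)).
Unshelve. all: by end_near. Qed.

End log_lift.

Section profiles.
Context {R : realType} {n : nat}.
Local Notation G := (@grushin R n).
Variables (a e : R).
Hypothesis e0 : 0 < e.

(** The strict inequalities make the vanishing set open, so derivatives of [B] inherit the
    property. *)
Definition supp12 (B : R -> R) := forall x, (x < 1) || (2 < x) -> B x = 0.

(* This is [rho ^ a * B (e * ln rho)], since [ln gauge = 4 * ln rho]. *)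
Definition profile (B : R -> R) (z : G) : R :=
  log_lift (fun x => expR (a / 4 * x) * B (e / 4 * x)) (gauge z).

Lemma supp12_derive1 B : supp12 B -> supp12 (derive1 B).
Proof.
move=> B0 x xB; rewrite derive1E (near_eq_derive (g := cst 0)) ?derive_cst//.
case/orP : xB => xB; near=> y; apply: B0; apply/orP; [left|right].
- by near: y; exact: lt_nbhsl.
- by near: y; exact: lt_nbhsr.
Unshelve. all: by end_near. Qed.

Lemma smooth_profile B : smooth1 B -> supp12 B -> smooth (profile B).
Proof.
move=> sB B0; apply: (@smooth_comp1 _ _ (log_lift _)); last exact: smooth_gauge.
(* Below [x = 4 / e] the argument [e / 4 * x] is less than 1, where [B] vanishes. *)
apply: (@smooth1_log_lift _ _ (4 / e)).
- by rewrite divr_gt0.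
- move=> x xe; rewrite B0 ?mulr0//; apply/orP; left.
  rewrite ltr_pdivlMr// in xe.
  by rewrite mulrAC ltr_pdivrMr// mul1r mulrC.
- apply: (@smooth1M _ (fun x => expR (a / 4 * x)) (fun x => B (e / 4 * x))).
    rewrite (_ : (fun _ => _) = expR \o (fun x => a / 4 * x + 0)).
      by apply: smooth1_comp; [exact: smooth1_expR|exact: smooth1_affine].
    by apply/funext => x; rewrite /= addr0.
  rewrite (_ : (fun _ => _) = B \o (fun x => e / 4 * x + 0)).
    by apply: smooth1_comp; [exact: sB|exact: smooth1_affine].
  by apply/funext => x; rewrite /= addr0.
Qed.

Lemma gauge_le_box (C : R) (z : G) : gauge z <= C ->
  (forall i, - (`|C| + 2) <= z.1 ord0 i <= `|C| + 2) /\ - (`|C| + 2) <= z.2 <= `|C| + 2.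
Proof.
move=> gz; set M := `|C| + 2; have C0 : 0 <= `|C| by [].
have {}gz := le_trans gz (ler_norm C).
have s0 : 0 <= sqn z by exact: sqn_ge0.
have sM : sqn z <= M by rewrite /gauge in gz; rewrite /M; nra.
have bd (x : R) : x ^+ 2 <= M -> - M <= x <= M.
  by move=> xM; rewrite /M in xM *; apply/andP; split; nra.
split=> [i|]; apply: bd.
  apply: le_trans sM; rewrite /sqn (bigD1 i)//= lerDl.
  by apply: sumr_ge0 => j _; exact: sqr_ge0.
by rewrite /gauge in gz; rewrite /M; nra.
Qed.

Lemma compact_gauge_le (C : R) : compact [set z : G | gauge z <= C].
Proof.
pose M := `|C| + 2.
apply: (@subclosed_compact _ _
    ([set v : 'rV[R]_n | forall i, `[- M, M]%classic (v ord0 i)] `*`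
     `[- M, M]%classic : set G)).
- rewrite (_ : [set z : G | _] = gauge @^-1` [set x | x <= C])//.
  apply: closed_comp; last exact: closed_le.
  by move=> z _; exact/smooth_continuous/smooth_gauge.
- apply: compact_setX; last exact: segment_compact.
  by apply: (@rV_compact _ _ (fun=> `[- M, M]%classic)) => _; exact: segment_compact.
- move=> z /gauge_le_box[z1 z2].
  by split=> [i|] /=; rewrite in_itv/=; [exact: z1|exact: z2].
Qed.

Lemma test_function_profile B : smooth1 B -> supp12 B -> test_function (profile B).
Proof.
move=> sB B0; split; first exact: smooth_profile.
(* [B] vanishes once [e * ln rho > 2], that is [gauge > expR (8 / e)]. *)
apply: (subclosed_compact _ (@compact_gauge_le (expR (8 / e)))).
  exact: closed_closure.
rewrite [X in _ `<=` X](closure_id _).1; last first.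
  apply: compact_closed; last exact: compact_gauge_le.
  exact: norm_hausdorff.
apply: closureS => z /=; apply: contraNT; rewrite -ltNge => gz; apply/eqP.
rewrite /profile /log_lift; case: ltP => // g0; rewrite B0 ?mulr0//; apply/orP; right.
have : 8 / e < ln (gauge z) by rewrite -ltr_expR lnK.
by rewrite ltr_pdivrMr// => H; rewrite mulrAC ltr_pdivlMr// mulrC; lra.
Qed.

(** Along the orbit [ln gauge] is [4 s + L], so the derivative in [s] gives [a] from the exponential
    and [e] from the argument of [B]. At the origin every profile and the coefficients of [Z]
    vanish. *)
Lemma shifted_euler_profile c B : smooth1 B -> supp12 B ->
  shifted_euler c (profile B) = profile (fun x => (a + c) * B x + e * derive1 B x).
Proof.
move=> sB B0; apply/funext => z; rewrite /shifted_euler.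
have [g0|] := ltP 0 (gauge z); last first.
  rewrite le_eqVlt ltNge gauge_ge0 orbF => /eqP/gauge_eq0 z0.
  have g0 : gauge z = 0.
    by rewrite z0 /gauge /sqn big1 => [|i _]; rewrite ?mxE !expr0n/= ?mulr0 ?addr0.
  have P0 D : profile D z = 0 by rewrite /profile /log_lift g0 ltxx.
  rewrite !P0 mulr0 addr0 z0 /euler big1 ?add0r ?mulr0 ?mul0r// => i _.
  by rewrite mxE mul0r.
pose L := ln (gauge z).
have PE D s : profile D (dilation s z) = expR (a / 4 * (4 * s + L)) * D (e / 4 * (4 * s + L)).
  rewrite /profile /log_lift gauge_dilation mulr_gt0 ?expR_gt0//.
  by rewrite lnM ?posrE ?expR_gt0// expRK.
have -> : euler (profile B) z = a * (expR (a / 4 * L) * B (e / 4 * L))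
    + e * (expR (a / 4 * L) * derive1 B (e / 4 * L)).
  apply: euler_is_derive; first exact: smooth_profile.
  rewrite (_ : (fun s => _) = fun s => expR (a / 4 * (4 * s + L)) * B (e / 4 * (4 * s + L))).
    have dB x : is_derive x (1 : R) B (derive1 B x) by exact: smooth1_is_derive.
    have dA k (s : R) : is_derive s (1 : R) (fun s => k / 4 * (4 * s + L)) k.
      by apply: is_derive_eq; rewrite addr0 /GRing.scale/=; field.
    have d1 := is_derive1_comp (is_derive_expR _) (dA a 0).
    have d2 := is_derive1_comp (dB _) (dA e 0).
    have := is_deriveM d1 d2.
    rewrite /= mulr0 add0r (_ : _ *: _ + _ *: _ = a * (expR (a / 4 * L) * B (e / 4 * L))
      + e * (expR (a / 4 * L) * derive1 B (e / 4 * L)))//.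
    by rewrite /GRing.scale/=; ring.
  by apply/funext => s; rewrite PE.
have PL D : profile D z = expR (a / 4 * L) * D (e / 4 * L).
  by rewrite /profile /log_lift g0.
by rewrite !PL; ring.
Qed.

End profiles.


Section box_measure.
Context {R : realType}.

Definition box n (a b : R) : set 'rV[R]_n := [set v | forall i, a <= v ord0 i <= b].

Lemma measurable_box n (a b : R) : measurable (@box n a b).
Proof.
rewrite (_ : box a b = \bigcap_(i in [set: 'I_n])
    (fun v : 'rV[R]_n => v ord0 i) @^-1` `[a, b]%classic).
  apply: fin_bigcap_measurable => // i _.
  by rewrite -[X in measurable X]setTI; exact: measurable_coord_rV.
apply/seteqP; split=> v /= H i; first by rewrite /= in_itv/= => _; exact: H.
by have := H i Logic.I; rewrite /= in_itv.
Qed.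

Lemma lebesgue_rV_box n (a b : R) : a <= b ->
  lebesgue_rV n (box a b) = ((b - a) ^+ n)%:E.
Proof.
move=> ab; elim: n => [|n IH].
  have B0 : box a b (0 : 'rV[R]_0) by case.
  by rewrite expr0 /= diracE mem_set.
rewrite (_ : box a b = @uncons_rV R n @^-1` (`[a, b]%classic `*` box a b)).
  rewrite lebesgue_rVS//; last exact: measurable_box.
  rewrite IH lebesgue_measure_itv/= lte_fin exprS EFinM.
  case: ltP => [_|ba]; first by rewrite -EFinB.
  by rewrite (_ : b - a = 0) ?mul0e//; apply/eqP; rewrite subr_eq0 eq_le ba ab.
apply/seteqP; split=> v /= H.
  split => /=; first by rewrite in_itv/= H.
  by move=> i; rewrite mxE; exact: H.
case: H => /= H0 H i; case: (@split_ordP 1 n i) => j ->.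
  have -> : lshift n j = (ord0 : 'I_n.+1) by apply/val_inj; rewrite ord1.
  by rewrite in_itv in H0.
by have := H j; rewrite mxE.
Qed.

End box_measure.

(** * The energy of a profile *)

Section profile_energy.
Context {R : realType} {n : nat}.
Local Notation G := (@grushin R n).
Local Notation mG := ('rV[R]_n * measurableTypeR R)%type.
Local Notation Q := (@hdim R n).
Local Notation mu := (@lebesgue_measure R).
Local Notation nu := (@grushin_sigma_finite R n).
Variables (p gam : R).
Hypothesis p1 : 1 < p.
Local Notation s0 := (@crit_exp R n p gam).

Let p0 : 0 < p. Proof. exact: lt_trans p1. Qed.

Lemma integral_affine (e b : R) (F : R -> R) : 0 < e -> continuous F -> (forall x, 0 <= F x) ->
  (\int[mu]_s (F (e * s + b))%:E = (e^-1)%:E * \int[mu]_s (F s)%:E)%E.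
Proof.
move=> e0 cF F0.
have dA (s : R) : is_derive s (1 : R) (fun s => e * s + b) e.
  by apply: is_derive_eq; rewrite addr0 [LHS]mulr1.
have DA : derive1 (fun s => e * s + b) = cst e.
  by apply/funext => s; rewrite derive1E (derive_val (is_derive := dA s)).
rewrite (@increasing_ge0_integration_by_substitutionT _ (fun s => e * s + b) F)//; last 6 first.
- by move=> x y xy; rewrite ltrD2r ltr_pM2l.
- by rewrite DA => x; exact: cvg_cst.
- by rewrite DA; exact: is_cvg_cst.
- by rewrite DA; exact: is_cvg_cst.
- have H : e * s @[s --> -oo] --> -oo by apply: gt0_cvgMrNy => //; exact: cvg_id.
  exact: (cvg_comp _ _ H (cvg_addrr_Ny b)).
- have H : e * s @[s --> +oo] --> +oo by apply: gt0_cvgMry => //; exact: cvg_id.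
  exact: (cvg_comp _ _ H (cvg_addrr b)).
rewrite DA -ge0_integralZl_EFin ?invr_ge0 ?(ltW e0)//.
- apply: eq_integral => s _; rewrite -EFinM; congr EFin.
  by rewrite [RHS]mulrC mulfK ?gt_eqF.
- by move=> s _; rewrite lee_fin mulr_ge0 ?F0 ?(ltW e0).
- apply/measurable_EFinP; apply: continuous_measurable_fun => s.
  apply: cvgM; last exact: cvg_cst.
  apply: (@continuous_comp _ _ _ (fun s => e * s + b) F); last exact: cF.
  exact/differentiable_continuous/derivable1_diffP/(ex_derive (is_derive := dA s)).
Qed.

Lemma continuous_norm_powR_comp (B : R -> R) : continuous B -> continuous (fun x => `|B x| `^ p).
Proof.
move=> cB x; apply: (@continuous_comp _ _ _ B (fun x => `|x| `^ p)); first exact: cB.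
exact: continuous_norm_powR.
Qed.

(** The angular factor: the integral over the shell of [psi^(p/2) rho^-Q]. It depends neither on [e]
    nor on [B]. *)
Definition shell_mass : \bar R :=
  (\int[nu]_(z in shell) (weight p gam z * expR (s0 * p / 4 * ln (gauge (z : G))))%:E)%E.

Lemma measurable_shell_density : measurable_fun setT
  (fun z : mG => (weight p gam z * expR (s0 * p / 4 * ln (gauge (z : G))))%:E).
Proof.
apply/measurable_EFinP; apply: measurable_funM; first exact: measurable_weight.
apply: (measurableT_comp (@measurable_expR R)).
apply: (measurableT_comp (mulrl_measurable _)).
exact: (measurableT_comp (@measurable_ln R) measurable_gauge).
Qed.

Lemma energy_profile (e : R) (B : R -> R) : 0 < e -> smooth1 B -> supp12 B ->
  @energy R n p gam (profile s0 e B) =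
    (shell_mass * ((e^-1)%:E * \int[mu]_s (`|B s| `^ p)%:E))%E.
Proof.
move=> e0 sB B0.
have sP := smooth_continuous (@smooth_profile _ n s0 _ e0 _ sB B0).
rewrite (energy_polar _ p1 sP) /shell_mass.
set I := ((e^-1)%:E * _)%E.
have I0 : (0 <= I)%E.
  apply: mule_ge0; first by rewrite lee_fin invr_ge0 ltW.
  by apply: integral_ge0 => s _; rewrite lee_fin powR_ge0.
rewrite -ge0_integralZr//; last 3 first.
- exact: measurable_shell.
- by move: measurable_shell_density; exact: measurable_funTS.
- by move=> z _; rewrite lee_fin mulr_ge0 ?weight_ge0 ?expR_ge0.
apply: eq_integral => z /[!inE] /andP[z1 _].
rewrite [X in _ = (X * _)%E](EFinM (weight p gam z)) -muleA; congr (_ * _)%E.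
have gz : 0 < gauge (z : G) by exact: lt_le_trans z1.
pose L := ln (gauge (z : G)).
(* Orbits start at different values of [L], but translation invariance gives them the same integral,
   with [e^-1] from the change of scale. *)
have -> : I = (\int[mu]_s (`|B (e * s + e * L / 4)| `^ p)%:E)%E.
  have cB : continuous (fun x => `|B x| `^ p).
    by apply: continuous_norm_powR_comp; exact: smooth1_continuous.
  by rewrite (integral_affine _ e0 cB)// => x; exact: powR_ge0.
rewrite -ge0_integralZl_EFin ?expR_ge0//.
- apply: eq_integral => s _; rewrite -EFinM; congr EFin.
  rewrite /ray /profile /log_lift gauge_dilation mulr_gt0 ?expR_gt0//.
  rewrite lnM ?posrE ?expR_gt0// expRK -/L mulrA -expRD normrM ger0_norm ?expR_ge0//.
  rewrite powRM ?expR_ge0// -expRM.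
  congr (expR _ * `|B _| `^ _); by field.
- apply/measurable_EFinP; apply: continuous_measurable_fun => s.
  apply: (@continuous_comp _ _ _ (fun s => e * s + e * L / 4) (fun x => `|B x| `^ p)).
    apply: cvgD; last exact: cvg_cst.
    by apply: cvgM; [exact: cvg_cst|exact: cvg_id].
  by apply: continuous_norm_powR_comp; exact: smooth1_continuous.
Qed.

Lemma shell_densityE (z : G) : 0 < gauge z ->
  weight p gam z * expR (s0 * p / 4 * ln (gauge z)) =
  psi z `^ (p / 2) * expR (- (Q / 4 * ln (gauge z))).
Proof.
move=> gz; rewrite /weight rhoE -powRrM /powR (gt_eqF gz) -/(powR _ _) -mulrA -expRD.
congr (_ * expR _); rewrite /crit_exp; field.
by rewrite gt_eqF.
Qed.

Lemma psi_le1 (z : G) : 0 < gauge z -> psi z <= 1.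
Proof.
move=> gz; rewrite psiE ler_pdivrMr ?powR_gt0// mul1r.
rewrite powR12_sqrt ?gauge_ge0// -[leLHS]ger0_norm ?sqn_ge0// -sqrtr_sqr.
by rewrite ler_sqrt ?gauge_ge0// /gauge lerDl mulr_ge0// sqr_ge0.
Qed.

Lemma grushin_sigma_finiteX A B : measurable A -> measurable B ->
  nu (A `*` B) = (lebesgue_rV n A * mu B)%E.
Proof. by move=> mA mB; exact: product_measure1E. Qed.

(** On the shell [psi <= 1] and [rho >= 1] bound the density by 1, and the shell lies in a bounded
    box. *)
Lemma shell_mass_fin : (shell_mass < +oo)%E.
Proof.
pose M : R := `|expR 4| + 2.
have M0 : 0 < M by rewrite /M ltr_wpDl.
pose D : set mG := box (- M) M `*` `[- M, M]%classic.
have mD : measurable D by apply: measurableX => //; exact: measurable_box.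
apply: (@le_lt_trans _ _ (nu D)); last first.
  rewrite grushin_sigma_finiteX//; last exact: measurable_box.
  rewrite lebesgue_rV_box ?lebesgue_measure_itv/= ?lte_fin; last by lra.
  by case: ifPn => _; rewrite -?EFinB -?EFinM ?mule0 ltry.
apply: (@le_trans _ _ (nu shell)); last first.
  apply: le_measure; rewrite ?inE//; first exact: measurable_shell.
  move=> z /andP[_ /ltW/gauge_le_box[z1 z2]]; split => /=; first exact: z1.
  by rewrite in_itv.
rewrite -[leRHS]mul1e -(integral_cst nu measurable_shell 1%E).
apply: ge0_le_integral; first exact: measurable_shell.
- by move=> z _; rewrite lee_fin mulr_ge0 ?weight_ge0 ?expR_ge0.
- exact: measurable_funTS measurable_shell_density.
- exact: measurable_cst.
move=> z /andP[z1 _]; rewrite lee_fin.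
have gz : 0 < gauge (z : G) by exact: lt_le_trans z1.
rewrite shell_densityE// mulr_ile1 ?powR_ge0 ?expR_ge0//.
  have p20 : 0 <= p / 2 by rewrite divr_ge0// ltW.
  have ps0 : psi (z : G) \is Num.nneg by rewrite nnegrE psiE divr_ge0 ?sqn_ge0 ?powR_ge0.
  have := ge0_ler_powR p20 ps0 (ler01 : 1 \is Num.nneg) (psi_le1 gz).
  by rewrite powR1.
rewrite expR_le1 oppr_le0 mulr_ge0 ?ln_ge0//.
by rewrite divr_ge0// /hdim addr_ge0.
Qed.

(** If the mass were zero, the density would vanish almost everywhere on the shell; it is positive
    on a box of positive measure inside it. *)
Lemma shell_mass_gt0 : (0 < n)%N -> (0 < shell_mass)%E.
Proof.
move=> n0; have n1 : (1 : R) <= n%:R by rewrite ler1n.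
(* On [D], [sqn] is positive and at most [n h^2 <= 1/4]; with [1/2 <= t <= 1] this gives
   [1 <= gauge < 5 <= expR 4]. *)
pose h : R := (2 * n%:R)^-1.
have h0 : 0 < h by rewrite invr_gt0; lra.
have nh : n%:R * h = 2^-1 by rewrite /h; field; rewrite gt_eqF//; lra.
pose D : set mG := box (h / 2) h `*` `[2^-1, 1]%classic.
have mD : measurable D by apply: measurableX => //; exact: measurable_box.
have Dsqn (z : G) : D z -> 0 < sqn z <= 4^-1.
  move=> [/= Dx _]; apply/andP; split.
    rewrite /sqn (bigD1 (Ordinal n0))//= ltr_pwDl//.
      by rewrite exprn_gt0//; have /andP[+ _] := Dx (Ordinal n0); lra.
    by apply: sumr_ge0 => i _; exact: sqr_ge0.
  apply: (@le_trans _ _ (\sum_(i < n) h ^+ 2)).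
    by apply: ler_sum => i _; have /andP[] := Dx i; nra.
  by rewrite sumr_const card_ord -[_ *+ n]mulr_natl; nra.
have Dgauge (z : G) : D z -> 0 < gauge z /\ shell z.
  move=> Dz; have /andP[sq0 sq1] := Dsqn z Dz.
  have /andP[t1 t2] : 2^-1 <= z.2 <= 1 by case: Dz => _; rewrite /= in_itv.
  have e4 : 1 + 4 <= expR 4 :> R by exact: expR_ge1Dx.
  have g1 : 1 <= gauge z by rewrite /gauge; nra.
  split; first exact: lt_le_trans g1.
  by rewrite /shell /= g1 /=; apply: lt_le_trans e4; rewrite /gauge; nra.
rewrite lt0e; apply/andP; split; last first.
  by apply: integral_ge0 => z _; rewrite lee_fin mulr_ge0 ?weight_ge0 ?expR_ge0.
apply/eqP => K0.
have mF := measurable_funTS (D := shell) measurable_shell_density.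
have [H _] := ae_eq_integral_abs nu measurable_shell mF.
have {H} : ae_eq nu shell (fun z : mG =>
    (weight p gam z * expR (s0 * p / 4 * ln (gauge (z : G))))%:E) (cst 0%E).
  apply: H; rewrite -[RHS]K0; apply: eq_integral => z _.
  by rewrite gee0_abs// lee_fin mulr_ge0 ?weight_ge0 ?expR_ge0.
move=> H; have : nu.-negligible D.
  apply: negligibleS H => z Dz /= Hz.
  have [gz sz] := Dgauge z Dz; have := Hz sz => -[]/eqP.
  apply/negP; rewrite gt_eqF// mulr_gt0 ?expR_gt0// /weight mulr_gt0//.
    rewrite powR_gt0// psiE divr_gt0 ?powR_gt0//.
    by have /andP[] := Dsqn z Dz.
  by rewrite powR_gt0// rhoE powR_gt0.
move=> /(measure_negligible mD) D0.
have mI : measurable (`[2^-1, 1]%classic : set (measurableTypeR R)) by exact: measurable_itv.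
have := etrans (esym (grushin_sigma_finiteX (@measurable_box _ n (h / 2) h) mI)) D0.
rewrite lebesgue_rV_box ?lebesgue_measure_itv/= ?lte_fin; last by lra.
have -> : (2^-1 < 1 :> R) by lra.
rewrite -EFinB -EFinM => -[] /eqP; apply/negP; rewrite gt_eqF//.
by rewrite mulr_gt0 ?exprn_gt0//; lra.
Qed.

End profile_energy.


Section profile_limit.
Context {R : realType}.
Local Notation mu := (@lebesgue_measure R).
Variables (p a : R).
Hypothesis p1 : 1 < p.

Let p0 : 0 < p. Proof. exact: lt_trans p1. Qed.

Definition shift_profile (e : R) (cs : seq R) (B : R -> R) : R -> R :=
  foldr (fun c D x => (a + c) * D x + e * derive1 D x) B cs.

Lemma smooth1_derive1n j (B : R -> R) : smooth1 B -> smooth1 (derive1n j B).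
Proof.
by move=> sB; elim: j => [|j IH]; [exact: sB|rewrite derive1nS; exact: smooth1_derive1].
Qed.

Lemma derive1n_lincomb (k l : R) j D : smooth1 D ->
  derive1n j (fun x => k * D x + l * derive1 D x) =
  fun x => k * derive1n j D x + l * derive1n j.+1 D x.
Proof.
move=> sD; elim: j => [//|j IH]; rewrite derive1nS IH; apply/funext => x.
have dj i : is_derive x (1 : R) (derive1n i D) (derive1n i.+1 D x).
  have -> : derive1n i.+1 D = derive1 (derive1n i D) by rewrite derive1nS.
  by apply: smooth1_is_derive; exact: smooth1_derive1n.
have dD := is_deriveD (is_deriveZ k (dj j)) (is_deriveZ l (dj j.+1)).
by rewrite derive1E (derive_val (is_derive := dD)).
Qed.

Lemma smooth1_lincomb (k l : R) D : smooth1 D ->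
  smooth1 (fun x => k * D x + l * derive1 D x).
Proof.
move=> sD; apply: (@smooth1D _ (fun x => k * D x) (fun x => l * derive1 D x)).
  by apply: (@smooth1M _ (cst k) D); [exact: smooth1_cst|].
by apply: (@smooth1M _ (cst l) (derive1 D)); [exact: smooth1_cst|exact: smooth1_derive1].
Qed.

Lemma smooth1_shift_profile e cs B : smooth1 B -> smooth1 (shift_profile e cs B).
Proof. by move=> sB; elim: cs => [|c cs IH]; [exact: sB|exact: smooth1_lincomb]. Qed.

Lemma supp12_shift_profile e cs (B : R -> R) : supp12 B -> supp12 (shift_profile e cs B).
Proof.
move=> B0; elim: cs => [|c cs IH]; first exact: B0.
move=> x xx; rewrite [LHS]/=.
by rewrite IH// (supp12_derive1 IH)// !mulr0 addr0.
Qed.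

Lemma smooth1_supp12_bounded (B : R -> R) : smooth1 B -> supp12 B ->
  exists M, forall x, `|B x| <= M.
Proof.
move=> sB B0.
have /compact_bounded/pinfty_ex_gt0[M M0 MP] : compact (B @` `[1, 2]%classic).
  apply: continuous_compact; last exact: segment_compact.
  by apply: continuous_subspaceT; exact: smooth1_continuous.
exists M => x; have [x12|] := boolP (1 <= x <= 2).
  by apply: MP; exists x => //=; rewrite in_itv.
by rewrite negb_and -!ltNge => /B0 ->; rewrite normr0 ltW.
Qed.

Lemma derive1n_supp12 j (B : R -> R) : supp12 B -> supp12 (derive1n j B).
Proof.
by move=> B0; elim: j => [|j IH]; [exact: B0|rewrite derive1nS; exact: supp12_derive1].
Qed.

(** All derivative orders [j] are treated together, since each new factor costs one more derivative
    of the previous function. The uniform bounds feed dominated convergence, with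
    [e = 1 / (m + 1)]. *)
Lemma shift_profile_limit cs (B : R -> R) j : smooth1 B -> supp12 B ->
  (exists M, forall m x, `|derive1n j (shift_profile m.+1%:R^-1 cs B) x| <= M) /\
  (forall x, derive1n j (shift_profile m.+1%:R^-1 cs B) x @[m --> \oo] -->
     (\prod_(c <- cs) (a + c)) * derive1n j B x).
Proof.
move=> sB B0; elim: cs j => [|c cs IH] j /=.
  have [M MP] := smooth1_supp12_bounded (@smooth1_derive1n j _ sB) (@derive1n_supp12 j _ B0).
  split; first by exists M.
  by move=> x; rewrite big_nil mul1r; exact: cvg_cst.
have dE m : derive1n j (fun x => (a + c) * shift_profile m.+1%:R^-1 cs B x +
    m.+1%:R^-1 * derive1 (shift_profile m.+1%:R^-1 cs B) x) = fun x =>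
    (a + c) * derive1n j (shift_profile m.+1%:R^-1 cs B) x +
    m.+1%:R^-1 * derive1n j.+1 (shift_profile m.+1%:R^-1 cs B) x.
  by apply: derive1n_lincomb; exact: smooth1_shift_profile.
have [[M MP] L] := IH j; have [[M' MP'] _] := IH j.+1.
split.
  exists (`|a + c| * M + M') => m x; rewrite dE.
  rewrite (le_trans (ler_normD _ _))// lerD//.
    by rewrite normrM ler_wpM2l.
  rewrite normrM -[leRHS]mul1r ler_pM//.
  by rewrite ger0_norm// invf_le1// ler1n.
move=> x; rewrite big_cons -mulrA.
have L' : m.+1%:R^-1 * derive1n j.+1 (shift_profile m.+1%:R^-1 cs B) x @[m --> \oo] --> (0 : R).
  apply: norm_cvg0.
  have H : m.+1%:R^-1 * M' @[m --> \oo] --> (0 : R).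
    by rewrite -[X in _ --> X](mul0r M'); apply: cvgM; [exact: cvg_harmonic|exact: cvg_cst].
  apply: (squeeze_cvgr _ (cvg_cst 0) H); apply: nearW => m.
  by rewrite normr_ge0 normrM ger0_norm// ler_wpM2l.
have := cvgD (cvgM (cvg_cst (a + c)) (L x)) L'; rewrite addr0 => H.
rewrite (_ : (fun m => _) = (fun m => (a + c) * derive1n j (shift_profile m.+1%:R^-1 cs B) x) +
    (fun m => m.+1%:R^-1 * derive1n j.+1 (shift_profile m.+1%:R^-1 cs B) x)); first exact: H.
by apply/funext => m; rewrite dE.
Qed.

Lemma integral_supp12 (B : R -> R) : supp12 B ->
  (\int[mu]_x (`|B x| `^ p)%:E = \int[mu]_(x in `[1%R, 2%R]) (`|B x| `^ p)%:E)%E.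
Proof.
move=> B0; rewrite [RHS]integral_mkcond; apply: eq_integral => x _.
rewrite patchE; case: ifPn => //; rewrite notin_setE /= in_itv/= => /negP.
by rewrite negb_and -!ltNge => /B0 ->; rewrite normr0 powR0// gt_eqF.
Qed.

Lemma shift_profile_energy_limit cs (B : R -> R) : smooth1 B -> supp12 B ->
  (\int[mu]_x (`|shift_profile m.+1%:R^-1 cs B x| `^ p)%:E @[m --> \oo] -->
   (\prod_(c <- cs) `|a + c| `^ p)%:E * \int[mu]_x (`|B x| `^ p)%:E)%E.
Proof.
move=> sB B0; have [[M MP] L] := @shift_profile_limit cs B 0 sB B0.
have cn (D : R -> R) : smooth1 D ->
    measurable_fun (`[1, 2]%classic : set (measurableTypeR R)) (fun x => (`|D x| `^ p)%:E).
  move=> sD; apply: measurable_funTS; apply/measurable_EFinP; apply: continuous_measurable_fun.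
  by apply: continuous_norm_powR_comp => //; exact: smooth1_continuous.
have -> : ((\prod_(c <- cs) `|a + c| `^ p)%:E * \int[mu]_x (`|B x| `^ p)%:E =
    \int[mu]_(x in `[1%R, 2%R]) (`|(\prod_(c <- cs) (a + c)) * B x| `^ p)%:E)%E.
  rewrite integral_supp12// -ge0_integralZl_EFin//; last 2 first.
  - exact: cn.
  - by apply: prodr_ge0 => c _; exact: powR_ge0.
  apply: eq_integral => x _; rewrite -EFinM normrM powRM//; congr (_ * _)%:E.
  elim: cs {L MP} => [|c cs IH]; first by rewrite !big_nil normr1 powR1.
  by rewrite !big_cons normrM powRM// IH.
have H : (\int[mu]_(x in `[1%R, 2%R]) (`|shift_profile m.+1%:R^-1 cs B x| `^ p)%:E @[m --> \oo] -->
    \int[mu]_(x in `[1%R, 2%R]) (`|(\prod_(c <- cs) (a + c)) * B x| `^ p)%:E)%E.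
  apply: (@dominated_cvg _ _ _ _ _ _ _ _ (cst ((`|M| `^ p)%:E))).
  - exact: measurable_itv.
  - by move=> m; apply: cn; exact: smooth1_shift_profile.
  - move=> x _; apply: cvg_EFin; first exact: nearW.
    exact: (cvg_comp _ _ (L x) (continuous_norm_powR p0 (x := _))).
  - by [].
  - apply: (@continuous_compact_integrable _ (cst (`|M| `^ p))); first exact: segment_compact.
    by apply: continuous_subspaceT => x; exact: cvg_cst.
  - move=> m x _; rewrite gee0_abs ?lee_fin ?powR_ge0//.
    apply: ge0_ler_powR; rewrite ?nnegrE ?(ltW p0)//.
    by rewrite (le_trans (MP m x))// ler_norm.
rewrite (_ : (fun m => _) = (fun m => \int[mu]_(x in `[1%R, 2%R])
    (`|shift_profile m.+1%:R^-1 cs B x| `^ p)%:E)%E); first exact: H.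
by apply/funext => m; rewrite integral_supp12//; exact: supp12_shift_profile.
Qed.

End profile_limit.


(** * Sharp inequality for products of shifted Euler fields *)

Section sharp_energy_inequality.
Context {R : realType} {n : nat}.
Local Notation G := (@grushin R n).
Local Notation Q := (@hdim R n).
Local Notation mu := (@lebesgue_measure R).
Variables (p gam : R).
Hypothesis p1 : 1 < p.
Local Notation s0 := (@crit_exp R n p gam).

Let p0 : 0 < p. Proof. exact: lt_trans p1. Qed.

Definition iter_shifted_euler (cs : seq R) (u : G -> R) : G -> R :=
  foldr (fun c w => shifted_euler c w) u cs.

Definition shift_constant (cs : seq R) : R := \prod_(c <- cs) `|s0 + c| `^ p.

Lemma test_function_iter cs u : test_function u -> test_function (iter_shifted_euler cs u).
Proof.
by move=> tu; elim: cs => [|c cs IH]; [exact: tu|exact: test_function_shifted_euler].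
Qed.

Lemma energy_iter_ge cs u : gam < Q -> test_function u ->
  ((shift_constant cs)%:E * energy p gam u <= energy p gam (iter_shifted_euler cs u))%E.
Proof.
move=> gQ tu; elim: cs => [|c cs IH]; first by rewrite /shift_constant big_nil mul1e.
rewrite /shift_constant big_cons EFinM -muleA.
have E := energy_shifted_euler p1 c gQ (test_function_iter cs tu).
have pc0 : (0 <= (`|s0 + c| `^ p)%:E)%E by rewrite lee_fin powR_ge0.
exact: (le_trans (lee_wpmul2l pc0 IH) E).
Qed.

Lemma iter_shifted_euler_profile e cs B : 0 < e -> smooth1 B -> supp12 B ->
  iter_shifted_euler cs (profile s0 e B) = profile s0 e (shift_profile s0 e cs B) :> (G -> R).
Proof.
move=> e0 sB B0; elim: cs => [//|c cs IH].
rewrite [LHS]/= -/(iter_shifted_euler cs _) IH shifted_euler_profile//.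
- exact: smooth1_shift_profile.
- exact: supp12_shift_profile.
Qed.

Lemma supp12_bump : supp12 (@bump_fun R).
Proof.
move=> x xB; apply: bump_out; rewrite negb_and -!leNgt.
by case/orP: xB => /ltW ->; rewrite ?orbT.
Qed.

Local Notation IB := (\int[mu]_x (`|bump_fun x| `^ p)%:E)%E.

Lemma bump_energy_fin : IB \is a fin_num.
Proof.
rewrite integral_supp12//; last exact: supp12_bump.
apply: integrable_fin_num => //.
apply: (@continuous_compact_integrable _ (fun x => `|bump_fun x| `^ p)); first exact: segment_compact.
apply: continuous_subspaceT; apply: continuous_norm_powR_comp => //.
exact/smooth1_continuous/smooth1_bump.
Qed.

Lemma bump_energy_gt0 : (0 < IB)%E.
Proof.
rewrite lt0e; apply/andP; split; last by apply: integral_ge0 => z _; rewrite lee_fin powR_ge0.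
apply/eqP => I0.
have mF : measurable_fun setT (fun x : measurableTypeR R => (`|bump_fun x| `^ p)%:E).
  apply/measurable_EFinP; apply: continuous_measurable_fun.
  apply: continuous_norm_powR_comp => //; exact/smooth1_continuous/smooth1_bump.
have [H _] := ae_eq_integral_abs mu measurableT mF.
have {}H : ae_eq mu setT (fun x : measurableTypeR R => (`|bump_fun x| `^ p)%:E) (cst 0%E).
  apply: H; rewrite -[RHS]I0; apply: eq_integral => z _.
  by rewrite gee0_abs// lee_fin powR_ge0.
have mI : measurable (`]1, 2[%classic : set (measurableTypeR R)) by exact: measurable_itv.
have N : mu.-negligible `]1, 2[%classic.
  apply: negligibleS H => x; rewrite /= in_itv/= => x12 /(_ Logic.I) -[] /eqP.
  by apply/negP; rewrite gt_eqF// powR_gt0// normr_gt0 gt_eqF// bump_gt0.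
have := etrans (esym (lebesgue_measure_itv `]1, 2[)) (measure_negligible mI N).
rewrite /= lte_fin ltr1n -EFinB => -[] /eqP.
by apply/negP; rewrite gt_eqF// subr_gt0 ltr1n.
Qed.

Lemma energy_iter_sharp cs (C : R) : (0 < n)%N ->
  (forall u : G -> R, test_function u ->
    (C%:E * energy p gam u <= energy p gam (iter_shifted_euler cs u))%E) ->
  C <= shift_constant cs.
Proof.
move=> n0 H.
have sb := @smooth1_bump R; have b0 := supp12_bump.
have K0 := @shell_mass_gt0 R n p gam n0.
have Kfin : @shell_mass R n p gam \is a fin_num.
  by rewrite ge0_fin_numE ?(ltW K0)//; exact: shell_mass_fin.
have step m : (C%:E * IB <= \int[mu]_x (`|shift_profile s0 m.+1%:R^-1 cs bump_fun x| `^ p)%:E)%E.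
  have e0 : (0 : R) < m.+1%:R^-1 by rewrite invr_gt0 ltr0n.
  have := H _ (@test_function_profile R n s0 _ e0 _ sb b0).
  rewrite iter_shifted_euler_profile// !energy_profile//; last 2 first.
  - exact: smooth1_shift_profile.
  - exact: supp12_shift_profile.
  (* Both sides carry the factors [shell_mass] and [e^-1], positive and finite, and these cancel. *)
  rewrite muleCA lee_pmul2l// muleCA lee_pmul2l// ?lte_fin ?invr_gt0//.
have L := @shift_profile_energy_limit R p s0 p1 cs _ sb b0.
have : (C%:E * IB <= (shift_constant cs)%:E * IB)%E.
  by apply: cvge_ge L; apply: nearW => m; exact: step.
by rewrite lee_pmul2r// ?bump_energy_fin ?bump_energy_gt0// lee_fin.
Qed.

End sharp_energy_inequality.


(** * The integrands and the constants *)

Section gauge_gradient.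
Context {R : realType} {n : nat}.
Local Notation G := (@grushin R n).
Implicit Types z : G.

Lemma sqn_line_x z i (h : R) : sqn (h *: xdir i + z) = sqn z + 2 * h * z.1 ord0 i + h ^+ 2.
Proof.
rewrite -addrA /sqn (eq_bigr (fun j => z.1 ord0 j ^+ 2 +
    (if j == i then 2 * h * z.1 ord0 i + h ^+ 2 else 0))); last first.
  move=> j _; rewrite !mxE eqxx /=; case: eqVneq => [->|_]; last by rewrite mulr0 add0r addr0.
  by rewrite mulr1; ring.
by rewrite big_split/= -big_mkcond big_pred1_eq.
Qed.

Lemma derive_gauge_x z i : 'D_(xdir i) gauge z = 4 * sqn z * z.1 ord0 i.
Proof.
apply: derive_val; apply/(is_derive_line gauge z (xdir i) _).2.
rewrite (_ : (fun _ => _) = fun h : R =>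
    (sqn z + 2 * h * z.1 ord0 i + h ^+ 2) ^+ 2 + 4 * z.2 ^+ 2); last first.
  by apply/funext => h; rewrite /gauge sqn_line_x /= scaler0 add0r.
by apply: is_derive_eq; rewrite /GRing.scale/=; ring.
Qed.

Lemma derive_gauge_t z : 'D_tdir gauge z = 8 * z.2.
Proof.
apply: derive_val; apply/(is_derive_line gauge z tdir _).2.
rewrite (_ : (fun _ => _) = fun h : R => sqn z ^+ 2 + 4 * (h + z.2) ^+ 2); last first.
  apply/funext => h; rewrite /gauge /=; congr (_ ^+ 2 + 4 * (_ + _) ^+ 2).
    by rewrite /sqn; apply: eq_bigr => i _; rewrite !mxE mulr0 add0r.
  exact: mulr1.
by apply: is_derive_eq; rewrite /GRing.scale/=; ring.
Qed.

Lemma derive_rho z v : 0 < gauge z ->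
  'D_v rho z = 4^-1 * gauge z `^ (4^-1 - 1) * 'D_v gauge z.
Proof.
move=> gz; rewrite (_ : rho = (fun x : R => x `^ 4^-1) \o (gauge : G -> R)); last first.
  by apply/funext => y; rewrite rhoE.
apply: derive_val; apply: is_derive_comp1; first exact: is_derive1_powR.
exact/smooth_is_derive/smooth_gauge.
Qed.

(** The squared Grushin gradient of [gauge] is [16 sqn^3 + 64 sqn t^2 = 16 sqn * gauge]; the chain
    rule for the power 1/4 multiplies it by [gauge^(-3/2) / 16]. *)
Lemma enorm_grushin_grad_rho z : 0 < gauge z -> enorm (grushin_grad rho z) = Num.sqrt (psi z).
Proof.
move=> gz; rewrite /enorm; congr Num.sqrt.
rewrite big_split_ord/= big_ord1.
rewrite (eq_bigr (fun i => (gauge z `^ (4^-1 - 1) * sqn z) ^+ 2 * z.1 ord0 i ^+ 2)); last first.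
  move=> i _; rewrite row_mxEl mxE /partial_x -/(xdir i) derive_rho// derive_gauge_x -exprMn.
  by congr (_ ^+ 2); field.
rewrite -mulr_sumr -/(sqn z) row_mxEr mxE eqxx mulr1n !exprMn enorm2.
rewrite /partial_t -/(tdir : G) derive_rho// derive_gauge_t psiE.
have -> : gauge z `^ 2^-1 = (gauge z `^ (4^-1 - 1)) ^- 2 / gauge z.
  by rewrite -powR_mulrn ?powR_ge0// -powRrM -powRN -{3}(powRr1 (gauge_ge0 z)) -powRB;
    [congr (_ `^ _); field|rewrite (gt_eqF gz) implybT].
have gn : gauge z != 0 by rewrite gt_eqF.
have pn : gauge z `^ (4^-1 - 1) != 0 by rewrite gt_eqF// powR_gt0.
set P := gauge z `^ _ in pn *.
rewrite [RHS](_ : _ = sqn z * P ^+ 2 * gauge z); last by field; rewrite pn gn.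
by rewrite /gauge; field.
Qed.

End gauge_gradient.


Section integrands.
Context {R : realType} {n : nat}.
Local Notation G := (@grushin R n).
Local Notation mG := ('rV[R]_n * measurableTypeR R)%type.
Local Notation Q := (@hdim R n).
Local Notation nu := (@grushin_sigma_finite R n).
Variables (p beta : R).
Hypothesis p1 : 1 < p.

Let p0 : 0 < p. Proof. exact: lt_trans p1. Qed.

Lemma rho_gt0 (z : G) : 0 < gauge z -> 0 < rho z.
Proof. by move=> gz; rewrite rhoE powR_gt0. Qed.

Lemma psi_ge0 (z : G) : 0 <= psi z.
Proof. by rewrite psiE divr_ge0 ?sqn_ge0 ?powR_ge0. Qed.

(** Here [y] is [psi]: the operator gives the power [x p], the denominator removes [d / 2], and
    [p / 2] must remain. At [y = 0] both sides vanish because [x] and [p] are positive. *)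
Lemma powR_balance (y r b x d e : R) : 0 <= y -> 0 < r -> 0 <= b -> 0 < x ->
  x * p - d / 2 = p / 2 ->
  (y `^ x * r `^ (- e) * b) `^ p / (Num.sqrt y `^ d * r `^ beta) =
  y `^ (p / 2) * r `^ (- (e * p + beta)) * b `^ p.
Proof.
move=> y0 r0 b0 x0 xd; rewrite !powRM ?mulr_ge0 ?powR_ge0// -!powRrM -powR12_sqrt// -powRrM.
rewrite invfM -!powRN opprD (gt0_powRD _ _ r0) mulNr.
have -> : y `^ (x * p) * r `^ (- (e * p)) * b `^ p * (y `^ (- (2^-1 * d)) * r `^ (- beta)) =
  (y `^ (x * p) * y `^ (- (2^-1 * d))) * (r `^ (- (e * p)) * r `^ (- beta)) * b `^ p by ring.
congr (_ * _ * _); move: y0; rewrite le_eqVlt => /predU1P[<-|y0].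
  by rewrite powR0 ?mulf_neq0 ?gt_eqF// mul0r powR0// gt_eqF// divr_gt0.
by rewrite -gt0_powRD//; congr (_ `^ _); lra.
Qed.

Lemma sqn_psi (z : G) l : 0 < gauge z ->
  sqn z ^+ l = psi z ^+ l * gauge z `^ (l%:R / 2).
Proof.
move=> gz; have E : gauge z `^ (l%:R / 2) = (gauge z `^ 2^-1) ^+ l.
  by rewrite -powR_mulrn ?powR_ge0// -powRrM mulrC.
by rewrite psiE expr_div_n E divfK// expf_neq0// gt_eqF// powR_gt0.
Qed.

Lemma norm_iter_radial_lap (l : nat) (u : G -> R) z : smooth u -> 0 < gauge z -> (0 < l)%N ->
  `|iter l radial_lap u z| =
    psi z `^ l%:R * rho z `^ (- (2 * l%:R)) * `|radial_symbol l u z|.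
Proof.
move=> su gz l0; rewrite iter_radial_lap// sqn_psi// !normrM (ger0_norm (exprn_ge0 l (psi_ge0 z))).
rewrite !(ger0_norm (powR_ge0 _ _)).
rewrite -(powR_mulrn _ (psi_ge0 z)) rhoE -powRrM.
rewrite (_ : 4^-1 * - (2 * l%:R) = - l%:R + l%:R / 2); last by field.
by rewrite gt0_powRD//; ring.
Qed.

Lemma enorm_radial_grad (f : G -> R) z :
  enorm (radial_grad f z) = Num.sqrt (psi z) * `|partial_rho f z|.
Proof.
rewrite /enorm big_ord_recl big1 => [|i _]; last by rewrite mxE expr0n.
by rewrite addr0 mxE eqxx sqrtr_sqr normrM ger0_norm// sqrtr_ge0.
Qed.

Lemma enorm_radial_grad_iter (l : nat) (u : G -> R) z : smooth u -> 0 < gauge z ->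
  enorm (radial_grad (iter l radial_lap u) z) =
    psi z `^ (l%:R + 2^-1) * rho z `^ (- (2 * l%:R + 1)) *
    `|shifted_euler (- 2 * l%:R) (radial_symbol l u) z|.
Proof.
move=> su gz; rewrite enorm_radial_grad.
have near_iter : \near z, iter l radial_lap u z =
    gauge z `^ (- l%:R) * (sqn z ^+ l * radial_symbol l u z).
  by move/near_gauge_gt0 : gz; apply: filterS => z'; exact: iter_radial_lap.
rewrite (partial_rho_homog (smooth_radial_symbol l su) gz near_iter).
rewrite (_ : 4 * - l%:R + 2 * l%:R = - 2 * l%:R); last by ring.
rewrite sqn_psi// !normrM (ger0_norm (exprn_ge0 l (psi_ge0 z))) !(ger0_norm (powR_ge0 _ _)).
rewrite -(powR_mulrn _ (psi_ge0 z)) -(powR12_sqrt (psi_ge0 z)) rhoE -powRrM.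
have -> : psi z `^ (l%:R + 2^-1) = psi z `^ 2^-1 * psi z `^ l%:R.
  have := psi_ge0 z; rewrite le_eqVlt => /predU1P[<-|y0]; last by rewrite -gt0_powRD// addrC.
  have h2 : l%:R + 2^-1 != 0 :> R by rewrite gt_eqF// ltr_wpDl.
  by rewrite (powR0 h2) (@powR0 _ 2^-1) ?mul0r// gt_eqF.
rewrite (_ : 4^-1 * - (2 * l%:R + 1) = (- l%:R - 4^-1) + l%:R / 2); last by field.
by rewrite (gt0_powRD (- l%:R - 4^-1) _ gz); ring.
Qed.

Lemma density_even (l : nat) (u : G -> R) z : smooth u -> 0 < gauge z -> (0 < l)%N ->
  `|iter l radial_lap u z| `^ p /
    (enorm (grushin_grad rho z) `^ ((2 * l%:R - 1) * p) * rho z `^ beta) =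
  weight p (2 * l%:R * p + beta) z * `|radial_symbol l u z| `^ p.
Proof.
move=> su gz l0; rewrite norm_iter_radial_lap// enorm_grushin_grad_rho//.
by rewrite powR_balance ?psi_ge0 ?rho_gt0// ?ltr0n//; field.
Qed.

Lemma density_odd (l : nat) (u : G -> R) z : smooth u -> 0 < gauge z ->
  enorm (radial_grad (iter l radial_lap u) z) `^ p /
    (enorm (grushin_grad rho z) `^ (2 * l%:R * p) * rho z `^ beta) =
  weight p ((2 * l%:R + 1) * p + beta) z *
    `|shifted_euler (- 2 * l%:R) (radial_symbol l u) z| `^ p.
Proof.
move=> su gz; rewrite enorm_radial_grad_iter// enorm_grushin_grad_rho//.
by rewrite powR_balance ?psi_ge0 ?rho_gt0// ?ltr_wpDl//; field.
Qed.

Lemma density_rhs (gam : R) (u : G -> R) z : 0 < gauge z ->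
  `|u z| `^ p * enorm (grushin_grad rho z) `^ p / rho z `^ gam =
  weight p gam z * `|u z| `^ p.
Proof.
move=> gz; rewrite enorm_grushin_grad_rho// -(powR12_sqrt (psi_ge0 z)) -powRrM.
by rewrite -powRN /weight (mulrC 2^-1); ring.
Qed.

Lemma grushin_set0E : [set (0 : mG)] = box 0 0 `*` [set 0].
Proof.
apply/seteqP; split=> [z ->|[x t] [/= x0 ->]].
  by split=> //= i; rewrite mxE lexx.
congr pair; apply/rowP => i; rewrite mxE; apply/eqP.
by rewrite eq_le andbC; exact: x0.
Qed.

Lemma measurable_grushin0 : measurable [set (0 : mG)].
Proof.
rewrite grushin_set0E.
by apply: measurableX; [exact: measurable_box|exact: measurable_set1].
Qed.

Lemma grushin0_null : nu [set (0 : mG)] = 0%E.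
Proof.
rewrite grushin_set0E grushin_sigma_finiteX; [|exact: measurable_box|exact: measurable_set1].
by rewrite lebesgue_measure_set1 mule0.
Qed.

(** The value of [f] at the origin is unconstrained apart from its sign: a measurable null singleton
    affects neither measurability nor the integral. *)
Lemma integral_grushin_energy (gam : R) (f v : G -> R) : continuous v ->
  (forall z, 0 <= f z) ->
  (forall z, 0 < gauge z -> f z = weight p gam z * `|v z| `^ p) ->
  (\int[grushin_measure]_z (f z)%:E)%E = energy p gam v.
Proof.
move=> cv f0 fE; rewrite integral_grushin_measure /energy.
pose g (z : mG) := (weight p gam z * `|v z| `^ p)%:E.
have mg : measurable_fun setT g by exact: measurable_energy_density.
have fg (z : mG) : z != 0 -> (f z)%:E = g z.
  by move=> z0; rewrite fE// gauge_gt0.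
apply: ge0_ae_eq_integral => //.
- rewrite -(setvU [set (0 : mG)]); apply/measurable_funU.
  + by apply: measurableC; exact: measurable_grushin0.
  + exact: measurable_grushin0.
  split; last exact: measurable_fun_set1.
  apply: (eq_measurable_fun g); last exact: measurable_funTS.
  by move=> z; rewrite inE /= => z0; rewrite fg//; apply/eqP.
- by move=> z _; rewrite lee_fin.
- by move=> z _; rewrite lee_fin mulr_ge0 ?weight_ge0 ?powR_ge0.
exists [set 0]; split; [exact: measurable_grushin0|exact: grushin0_null|].
move=> z /= H; apply: contrapT => /eqP z0; apply: H => _.
exact: fg.
Qed.

End integrands.


Section constants.
Context {R : realType} {n : nat}.
Local Notation G := (@grushin R n).
Local Notation Q := (@hdim R n).
Variables (p beta : R).
Hypothesis p1 : 1 < p.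

Let p0 : 0 < p. Proof. exact: lt_trans p1. Qed.

Fixpoint radial_shifts (l : nat) : seq R :=
  if l is m.+1 then [:: Q - 2 - 2 * m%:R, - 2 * m%:R & radial_shifts m] else [::].

Lemma radial_symbolE l (u : G -> R) :
  radial_symbol l u = iter_shifted_euler (radial_shifts l) u.
Proof. by elim: l => //= l ->. Qed.

(** With [k = 2 l + d], the pair [s0 + Q - 2 - 2 m], [s0 - 2 m] has product minus the base of
    [Lambda] of index [k - 2 m]; the parity of [k] enters through [d]. *)
Lemma shift_constant_radial (d l : nat) :
  @shift_constant R n p ((2 * l%:R + d%:R) * p + beta) (radial_shifts l) =
  \prod_(0 <= i < l) Lambda Q p beta (i.+1.*2 + d).
Proof.
set gam := (_ + beta); set s0 := @crit_exp R n p gam.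
have -> : @shift_constant R n p gam (radial_shifts l) = \prod_(0 <= m < l)
    (`|s0 + (Q - 2 - 2 * m%:R)| `^ p * `|s0 + - 2 * m%:R| `^ p).
  rewrite /shift_constant -/s0; move: s0 => s; elim: l {gam} => [|l IH].
    by rewrite big_nil big_geq.
  by rewrite big_nat_recr//= !big_cons IH mulrA mulrC.
(* Increasing [m] lowers the index of [Lambda], so the two products run in opposite orders. *)
rewrite big_nat_rev/= add0n; apply: eq_big_nat => i /andP[_ il].
rewrite /Lambda doubleS addSn addSn eqSS [_.+1 == 0%N]/= -powRM// -normrM.
rewrite -[in RHS]normrN; congr (`| _ | `^ _).
have -> : (l - i.+1)%:R = l%:R - (i%:R + 1) :> R by rewrite natrB// natr1.
have -> : (i.*2 + d).+2%:R = 2 * (i%:R + 1) + d%:R :> R.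
  by rewrite -addn2 !natrD -muln2 natrM; ring.
rewrite /s0 /crit_exp /gam /hdim; field.
by rewrite gt_eqF.
Qed.

Lemma rellich_constant_even l :
  rellich_constant Q p beta (2 * l) =
  @shift_constant R n p (2 * l%:R * p + beta) (radial_shifts l).
Proof.
have := shift_constant_radial 0 l; rewrite addr0 => ->.
rewrite /rellich_constant mul2n odd_double/= doubleK big_add1/=.
by apply: eq_bigr => i _; rewrite addn0.
Qed.

(** The extra first-order factor is [s0 - 2 l = - (Q - p - beta) / p]. [Lambda] of index 1 has no
    absolute value, so the upper bound on [beta] settles the sign. *)
Lemma rellich_constant_odd l : beta < Q - (2 * l%:R + 1) * p ->
  rellich_constant Q p beta (2 * l + 1) =
  @shift_constant R n p ((2 * l%:R + 1) * p + beta) (- 2 * l%:R :: radial_shifts l).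
Proof.
move=> bQ; rewrite /shift_constant big_cons -/(shift_constant _ _ _) (shift_constant_radial 1 l).
rewrite /rellich_constant mul2n addn1 /= odd_double/= uphalf_double big_nat_recl//.
congr (_ * _); last by apply: eq_bigr => i _; rewrite addn1.
rewrite /Lambda/=; congr (_ `^ _); rewrite /crit_exp ler0_norm.
  by rewrite /hdim; field; rewrite gt_eqF.
have c0 : ((2 * l%:R + 1) * p + beta - Q) / p <= 0.
  by rewrite pmulr_lle0 ?invr_gt0// subr_le0 -lerBrDl ltW.
have l0 : 0 <= l%:R :> R by [].
lra.
Qed.

End constants.

Theorem theorem4p3 (R : realType) (n k : nat) (p beta : R) (Q : R)
    (n_ge1 : (1 <= n)%N) (QE : Q = @hdim R n)
    (k_ge1 : (1 <= k)%N) (k_ltQ : k%:R < Q)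
    (p_gt1 : 1 < p) (p_ltQk : p < Q / k%:R) :
  (forall l : nat, (1 <= l)%N -> k = (2 * l)%N ->
    - (2 * l%:R - 2) * p - Q * (p - 1) < beta ->
    beta < Q - 2 * l%:R * p ->
    sharp_inequality
      (fun u : @grushin R n -> R =>
        \int[grushin_measure]_z
          (`|iter l radial_lap u z| `^ p /
           (enorm (grushin_grad rho z) `^ ((2 * l%:R - 1) * p) *
            rho z `^ beta))%:E)%E
      (fun u : @grushin R n -> R =>
        \int[grushin_measure]_z
          (`|u z| `^ p * enorm (grushin_grad rho z) `^ p /
           rho z `^ (2 * l%:R * p + beta))%:E)%E
      (rellich_constant Q p beta k)) /\
  (forall l : nat, k = (2 * l + 1)%N ->
    - (2 * l%:R - 1) * p - Q * (p - 1) < beta ->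
    beta < Q - (2 * l%:R + 1) * p ->
    sharp_inequality
      (fun u : @grushin R n -> R =>
        \int[grushin_measure]_z
          (enorm (radial_grad (iter l radial_lap u) z) `^ p /
           (enorm (grushin_grad rho z) `^ (2 * l%:R * p) *
            rho z `^ beta))%:E)%E
      (fun u : @grushin R n -> R =>
        \int[grushin_measure]_z
          (`|u z| `^ p * enorm (grushin_grad rho z) `^ p /
           rho z `^ ((2 * l%:R + 1) * p + beta))%:E)%E
      (rellich_constant Q p beta k)).
Proof.
(* Both parities are instances of one statement about energies; they differ only in [gam] and the
   list of shifts. *)
have sharp (gam : R) (cs : seq R) (lhs rhs : (@grushin R n -> R) -> \bar R) : gam < Q ->
    (forall u, test_function u -> lhs u = energy p gam (iter_shifted_euler cs u)) ->
    (forall u, test_function u -> rhs u = energy p gam u) ->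
    sharp_inequality lhs rhs (@shift_constant R n p gam cs).
  move=> gQ lhsE rhsE; split=> [u tu|C' HC].
    by rewrite lhsE// rhsE//; apply: energy_iter_ge => //; rewrite -QE.
  apply: energy_iter_sharp => // u tu.
  by rewrite -lhsE// -rhsE//; exact: HC.
have rhsE gam u : test_function u -> (\int[grushin_measure]_z
    (`|u z| `^ p * enorm (grushin_grad rho z) `^ p / rho z `^ gam)%:E)%E =
    energy p gam u.
  move=> [su _]; apply: integral_grushin_energy => //.
  - exact: smooth_continuous.
  - by move=> z; rewrite divr_ge0 ?mulr_ge0 ?powR_ge0.
  - by move=> z gz; rewrite density_rhs.
split=> l.
- move=> l1 -> _ bQ; rewrite QE rellich_constant_even//.
  apply: sharp => [|u tu|u tu]; [by rewrite -ltrBrDl| |exact: rhsE].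
  have [su _] := tu; rewrite -radial_symbolE.
  apply: integral_grushin_energy => //.
  + exact/smooth_continuous/smooth_radial_symbol.
  + by move=> z; rewrite divr_ge0 ?mulr_ge0 ?powR_ge0.
  + by move=> z gz; exact: density_even.
- move=> -> _ bQ; rewrite QE rellich_constant_odd -?QE//.
  apply: sharp => [|u tu|u tu]; [by rewrite -ltrBrDl| |exact: rhsE].
  have [su _] := tu.
  have -> : iter_shifted_euler (- 2 * l%:R :: @radial_shifts R n l) u =
    shifted_euler (- 2 * l%:R) (radial_symbol l u) by rewrite radial_symbolE.
  apply: integral_grushin_energy => //.
  + exact/smooth_continuous/smooth_shifted_euler/smooth_radial_symbol.
  + by move=> z; rewrite divr_ge0 ?mulr_ge0 ?powR_ge0.
  + by move=> z gz; exact: density_odd.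
Qed.
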